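(* Let $q\ge1$ be an integer and $0\le\gamma\le1$. Consider the $(\vec\alpha,\vec\beta,\gamma)$ shuffle with $\vec\beta=\vec0$ and $\alpha_1=\cdots=\alpha_q=\frac{1-\gamma}q$ (and $\alpha_i=0$ for $i>q$). For a permutation $\pi$ let $N_i(\pi)$ be its number of $i$-cycles. 1. Fix $u$ with $0<u<1$. Choose a random deck size, with probability of getting $n$ equal to $(1-u)u^n$ ($n\ge0$), and then let $\pi$ be distributed as this shuffle on a deck of that size. Then the random variables $N_i$, $i\ge1$, are independent, where $N_i$ is the convolution of a $\mathrm{Poisson}\big(u^i(1-(1-\gamma)^i)/i\big)$ with $\frac1i\sum_{d\mid i}\mu(d)q^{i/d}$ many geometrics with parameter $\left(\frac{u(1-\gamma)}q\right)^i$. 2. Let $\pi$ be distributed as this shuffle on a deck of $n$ cards. Then as $n\to\infty$ the random variables $N_i$, $i\ge1$, are independent in the limit (they converge jointly, in the sense of finite-dimensional distributions, to independent random variables), where the limit of $N_i$ is the convolution of a $\mathrm{Poisson}\big((1-(1-\gamma)^i)/i\big)$ with $\frac1i\sum_{d\mid i}\mu(d)q^{i/d}$ many geometrics with parameter $\left(\frac{1-\gamma}q\right)^i$.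
   Context: **$(\vec\alpha,\vec\beta,\gamma)$ shuffle** (for non-negative parameters with $\gamma+\sum\alpha_i+\sum\beta_i=1$). This is the following probability measure on $S_n$. Choose a word $w_1\cdots w_n$ of integers with independent letters: each letter equals $i>0$ with probability $\alpha_i$, equals $-i<0$ with probability $\beta_i$ ($i\geq 1$), and equals $0$ with probability $\gamma$. Process the distinct letters occurring in the word in increasing order (usual order on $\mathbb Z$), assigning to the positions of each letter the next unused block of consecutive integers from $1,2,\dots,n$ (the block having as many elements as the letter has occurrences). Within the block of a negative letter, the integers are written under its occurrences in decreasing order from left to right. Within the block of a positive letter, they are written in increasing order from left to right. Within the block of the letter $0$, they are written in a uniformly random order (independent of everything else). Then $\pi(j)$ is the integer written under $w_j$. A geometric random variable with parameter $a$ takes the value $m\in\{0,1,2,\dots\}$ with probability $(1-a)a^m$. ''Convolution of a Poisson with $M$ many geometrics'' means the law of the sum of independent random variables, one Poisson and $M$ geometric. $\mu$ is the Möbius function of elementary number theory. For a deck of size $0$ all $N_i$ are $0$. *)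

(* Defs.v *)
(* MathComp-Analysis, over an arbitrary R : realType. *)
From mathcomp Require Import all_boot all_order all_algebra all_fingroup.
From mathcomp Require Import all_classical all_reals all_analysis.
Set Implicit Arguments.
Unset Strict Implicit.
Unset Printing Implicit Defensive.
Import Order.TTheory GRing.Theory Num.Theory.
Import numFieldNormedType.Exports.
Local Open Scope classical_set_scope.
Local Open Scope ring_scope.

(* Deck positions and card labels 1, ..., n are encoded as 'I_n, that is
   0, ..., n - 1. *)

Definition block_start (n : nat) (w : {ffun 'I_n -> int}) (j : 'I_n) : nat :=
  #|[pred k : 'I_n | w k < w j]|.

Definition block_size (n : nat) (w : {ffun 'I_n -> int}) (a : int) : nat :=
  #|[pred k : 'I_n | w k == a]|.

(* pi can be written under the word w: every label is forced, except that the
   labels under the letter 0 may come in any order within their block. *)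
Definition written_under (n : nat) (w : {ffun 'I_n -> int}) (pi : 'S_n) : bool :=
  [forall j : 'I_n,
    if 0 < w j then
      pi j == (block_start w j + #|[pred k : 'I_n | (w k == w j) && (k < j)%N]|)%N
                :> nat
    else if w j < 0 then
      pi j == (block_start w j + #|[pred k : 'I_n | (w k == w j) && (j < k)%N]|)%N
                :> nat
    else (block_start w j <= pi j < block_start w j + block_size w 0)%N].

Section Probability.
Variable R : realType.

(* Probability of the event E under the law on T with point masses p >= 0. *)
Definition Pr (T : choiceType) (p : T -> R) (E : set T) : R :=
  fine (\esum_(x in E) (p x)%:E).

Definition mutually_independent (T : choiceType) (p : T -> R) (I : set nat)
    (X : nat -> T -> nat) : Prop :=
  forall (s : seq nat) (A : nat -> set nat),
    uniq s -> (forall i, i \in s -> I i) ->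
    Pr p [set x | forall i, i \in s -> A i (X i x)] =
      \prod_(i <- s) Pr p [set x | A i (X i x)].

(* Negz i is the integer - (i + 1); the values alpha 0 and beta 0 are unused. *)
Definition letter_pmf (alpha beta : nat -> R) (gamma : R) (a : int) : R :=
  match a with
  | Posz 0 => gamma
  | Posz i.+1 => alpha i.+1
  | Negz i => beta i.+1
  end.

(* Given w, the m! permutations that can be written under w, where m is the
   number of letters 0, are equally likely. *)
Definition shuffle_pmf (alpha beta : nat -> R) (gamma : R) (n : nat)
    (pi : 'S_n) : R :=
  fine (\esum_(w in [set: {ffun 'I_n -> int}])
    ((\prod_(j < n) letter_pmf alpha beta gamma (w j)) *
     ((written_under w pi)%:R / ((block_size w 0)`!)%:R))%:E).

(* The law of a pair (deck size, permutation): the size is n with probability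
   (1 - u) u^n, and given n the permutation has point masses p n. *)
Definition random_deck_pmf (u : R) (p : forall n, 'S_n -> R)
    (x : {n : nat & 'S_n}) : R :=
  (1 - u) * u ^+ tag x * p (tag x) (tagged x).

(* At lambda = 0 this is the point mass at 0, unlike the library's poisson_pmf,
   which is constantly 1 there. *)
Definition poisson_mass (lambda : R) (m : nat) : R :=
  lambda ^+ m / (m`!)%:R * expR (- lambda).

Definition geometric_mass (a : R) (m : nat) : R := (1 - a) * a ^+ m.

Definition convolution (p q : nat -> R) (m : nat) : R :=
  \sum_(k < m.+1) p k * q (m - k)%N.

Definition poisson_geometrics (lambda : R) (M : nat) (a : R) : nat -> R :=
  iter M (convolution (geometric_mass a)) (poisson_mass lambda).

End Probability.

Definition ncycles (i n : nat) (pi : 'S_n) : nat :=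
  #|[pred C in porbits pi | #|C| == i]|.

Definition moebius (d : nat) : int :=
  if all (fun p => logn p d == 1%N) (primes d) then (-1) ^+ size (primes d)
  else 0.

(* Main.v *)
Require Import Defs.
From mathcomp Require Import all_boot all_order all_algebra all_fingroup.
From mathcomp Require Import all_classical all_reals all_analysis.
From mathcomp Require Import ring.
Set Implicit Arguments.
Unset Strict Implicit.
Unset Printing Implicit Defensive.

(* Read the letters met along the cycle of each card under the inverse of the
   shuffled permutation: the cards are in lexicographic order of these periodic
   words, so a word is determined by the multiset of its periodic words (Gessel's
   bijection).  Sorting the cards of an arbitrary
   coloured permutation by the same periodic words shows that this multiset has
   the same law for a random word as for a uniform permutation with independent
   coloured cards; letters 0 are made distinct by labelling them with the cards
   they receive.  A cycle of the shuffle of length i thus becomes a point of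
   period i in a uniform coloured permutation.  Removing the cycle of one card
   gives P_n (N_i = k, E) = b_i(k) P_(n - i k) (N_i = 0, E), for every event E
   on the other N_j, where sum_k b_i(k) x^k = exp (lambda_i x) / (1 - a_i x)^M_i
   and M_i counts the primitive necklaces of length i.  Weighting by (1 - u) u^n
   makes this a product formula, which is part 1.  For part 2, inverting the
   power series turns P_n (E) into P_n (N_i = 0, E), and the inverse series
   exp (- lambda_i x) (1 - a_i x)^M_i converges absolutely at x = 1. *)

(** * Standardization and periodic words *)

Section Periods.
Variable A : Type.
Implicit Types s : nat -> A.

(** The cycles of the shuffle are coupled through the sorting of the letters, whereas in a uniform
    coloured permutation a cycle can be removed together with its colours; this is why the law is
    moved there. The obstacle is ties: cards with equal periodic words can be sorted in several
    ways, so a word corresponds to many coloured permutations. Their number must be the same for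
    every word, and it is [n!]: the permutations preserving ties form a group, whose cosets arrange
    the periodic words on the cards and whose elements splice tied cycles together. Splicing is why
    a cycle of length [l] may read a word of length [i] repeated [l / i] times; it then stands for
    [l / i] cycles of length [i] of the shuffle. A zero-free primitive word of length [i] thus
    contributes at every multiple of [i], which gives the logarithm of a geometric series: one
    geometric variable per necklace. A word meeting a labelled zero is never a repetition and
    contributes at length [i] alone, which gives an exponential: the Poisson part, whose rate is the
    chance [1 - (1 - gamma)^i] of meeting a zero, divided by [i]. *)

Definition is_period s p := forall t, s (t + p) = s t.

(** The value 0 stands for a stream without positive period; every stream met below is periodic. *)
Definition min_period s : nat :=
  if pselect (exists p, (0 < p) && `[< is_period s p >]) is left ex_p
  then ex_minn ex_p else 0.

Lemma is_periodM s p m : is_period s p -> is_period s (m * p).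
Proof.
by move=> ps; elim: m => [|m IHm] t; rewrite ?addn0 // mulSn addnCA addnC ps.
Qed.

Lemma min_periodP s N : 0 < N -> is_period s N ->
  [/\ 0 < min_period s, is_period s (min_period s)
    & forall p, is_period s p -> min_period s %| p].
Proof.
move=> N_gt0 sN; rewrite /min_period; case: pselect => [ex_p|[]]; last first.
  by exists N; rewrite N_gt0; apply/asboolP.
case: ex_minnP => d /andP[d_gt0 /asboolP sd] d_min; split=> // p sp.
rewrite /dvdn -leqn0 leqNgt; apply/negP => r_gt0.
have := ltn_pmod p d_gt0; rewrite ltnNge => /negP; apply.
apply: d_min; rewrite r_gt0; apply/asboolP => t.
by rewrite -(is_periodM (p %/ d) sd) -addnA [_ %% _ + _]addnC -divn_eq sp.
Qed.

End Periods.

(** Two alphabets are allowed, so that a labelled word can be compared with its collapse. *)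
Lemma eq_min_period (A B : Type) (s : nat -> A) (s' : nat -> B) :
  (forall p, is_period s p <-> is_period s' p) -> min_period s = min_period s'.
Proof.
move=> ss'; rewrite /min_period.
by have -> : is_period s = is_period s' by apply/funext => p; apply/propext.
Qed.

Definition stream (T : finType) (A : Type) (s : {perm T}) (c : T -> A) (x : T)
  (t : nat) : A := c (iter t s x).

Section Streams.
Variables (T : finType) (A : Type) (s : {perm T}) (c : T -> A).

Lemma stream_shift x t : stream s c (iter t s x) = fun r => stream s c x (r + t).
Proof. by apply/funext => r; rewrite /stream iterD. Qed.

Lemma stream_iter_eq x y t :
  stream s c x = stream s c y -> stream s c (iter t s x) = stream s c (iter t s y).
Proof. by move=> xy; rewrite !stream_shift xy. Qed.

(** The inverse of [s] is one of its iterates, and iterating forward preserves equality of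
    streams. *)
Lemma stream_perm_inj x y :
  stream s c (s x) = stream s c (s y) -> stream s c x = stream s c y.
Proof.
move=> xy; have iterK z : iter #[s]%g.-1 s (s z) = z.
  by rewrite -iterSr prednK ?order_gt0 // -permX expg_order perm1.
by rewrite -[x]iterK -[y]iterK; apply: stream_iter_eq.
Qed.

Lemma stream_period x p :
  is_period (stream s c x) p <-> stream s c (iter p s x) = stream s c x.
Proof.
rewrite stream_shift; split=> [xp|xp t]; first exact/funext.
by rewrite -[in RHS]xp.
Qed.

Lemma card_porbit_period x : is_period (stream s c x) #|porbit s x|.
Proof. by apply/stream_period; rewrite iter_porbit. Qed.

Lemma card_porbit_gt0 x : 0 < #|porbit s x|.
Proof. by apply/card_gt0P; exists x; apply: porbit_id. Qed.

Lemma iter_fix_porbit x p : 0 < p -> iter p s x = x -> #|porbit s x| <= p.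
Proof.
move=> p_gt0 xp; apply: leq_trans (_ : #|traject s x p| <= p); last first.
  by rewrite (leq_trans (card_size _)) ?size_traject.
apply/subset_leq_card/fintype.subsetP => y /porbitP[i ->]; rewrite permX.
have xpm m : iter (m * p) s x = x.
  by elim: m => // m IHm; rewrite mulSn iterD IHm xp.
apply/trajectP; exists (i %% p); first by rewrite ltn_pmod.
by rewrite {1}(divn_eq i p) addnC iterD xpm.
Qed.

End Streams.

Section StreamCode.
Variable k : nat.
Implicit Types s : nat -> 'I_k.

(* The first t letters of s, read as a number in base k: comparing codes is
   comparing prefixes lexicographically. *)
Fixpoint code s t : nat :=
  if t is t'.+1 then s 0 * k ^ t' + code (fun r => s r.+1) t' else 0.

Lemma code_lt s t : code s t < k ^ t.
Proof.
elim: t s => //= t IHt s; apply: leq_trans (_ : (s 0).+1 * k ^ t <= _).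
  by rewrite mulSnr ltn_add2l.
by rewrite expnS leq_mul2r ltn_ord orbT.
Qed.

Lemma code_inj s s' : (forall t, code s t = code s' t) -> s = s'.
Proof.
move=> ss'; apply/funext => r; elim: r s s' ss' => [|r IHr] s s' ss'.
  by apply/val_inj; have /= := ss' 1; rewrite !muln1 !addn0.
have s0 : s 0 = s' 0 :> nat by have /= := ss' 1; rewrite !muln1 !addn0.
apply: (IHr (fun r => s r.+1) (fun r => s' r.+1)) => t.
by have /= := ss' t.+1; rewrite s0 => /addnI.
Qed.

End StreamCode.

(** The two lists of values are sorted and each is a rearrangement of the other, so they are the
    same list. *)
Lemma monotone_rearrangement (n : nat) (f g : 'I_n -> nat) (s : 'S_n) :
  {homo f : x y / x <= y} -> {homo g : x y / x <= y} ->
  (forall x, f x = g (s x)) -> f =1 g.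
Proof.
have sorted_map (h : 'I_n -> nat) : {homo h : x y / x <= y} ->
    sorted leq (map h (enum 'I_n)).
  move=> h_mono; rewrite sorted_map.
  apply: (sub_sorted (e := fun x y : 'I_n => x <= y)) => [x y|]; first exact: h_mono.
  by have := iota_sorted 0 n; rewrite -val_enum_ord sorted_map.
move=> f_mono g_mono fg x.
suff: map f (enum 'I_n) = map g (enum 'I_n).
  by move=> /eq_in_map fgE; apply: fgE; rewrite mem_enum.
apply: (sorted_eq leq_trans anti_leq); [exact: sorted_map | exact: sorted_map |].
rewrite (eq_map fg) (map_comp g s) perm_map //; apply: uniq_perm.
- by rewrite map_inj_uniq ?enum_uniq //; apply: perm_inj.
- exact: enum_uniq.
move=> y; rewrite mem_enum; apply/mapP; exists ((s^-1)%g y); rewrite ?mem_enum //.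
by rewrite permKV.
Qed.

Section Standardization.
Variables n k : nat.
Implicit Types w : {ffun 'I_n -> 'I_k}.

(** Ties between equal letters are broken from left to right, so [std w] is the permutation written
    under [w] when all letters are treated as positive. *)
Definition word_lt w (i j : 'I_n) := (w i < w j) || ((w i == w j) && (i < j)).

Definition rank w j := #|[pred i | word_lt w i j]|.

Lemma word_lt_irr w : irreflexive (word_lt w).
Proof. by move=> i; rewrite /word_lt !ltnn andbF. Qed.

Lemma word_lt_trans w : transitive (word_lt w).
Proof.
move=> j i l; rewrite /word_lt => /orP[ij|/andP[/eqP -> ij]] /orP[jl|/andP[/eqP <- jl]].
- by rewrite (ltn_trans ij jl).
- by rewrite ij.
- by rewrite jl.
- by rewrite eqxx (ltn_trans ij jl) orbT.
Qed.

Lemma word_lt_total w i j : i != j -> word_lt w i j || word_lt w j i.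
Proof.
rewrite /word_lt -(inj_eq val_inj i) -(inj_eq val_inj (w i)) -(inj_eq val_inj (w j)) /=.
by case: (ltngtP (w i) (w j)) => //= _; case: ltngtP.
Qed.

Lemma rank_mono w i j : word_lt w i j -> rank w i < rank w j.
Proof.
move=> ij; apply/proper_card/properP; split.
  by apply/fintype.subsetP => l; rewrite !inE => /word_lt_trans; apply.
by exists i; rewrite !inE ?word_lt_irr.
Qed.

Lemma rank_lt w j : rank w j < n.
Proof.
rewrite -[X in _ < X](card_ord n); apply/proper_card/properP; split.
  exact/fintype.subsetP.
by exists j; rewrite !inE ?word_lt_irr.
Qed.

Lemma rank_inj w : injective (fun j => Ordinal (rank_lt w j)).
Proof.
move=> i j /(congr1 val) /= eq_ij; apply/eqP/negPn/negP => /(word_lt_total w).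
by case/orP => /rank_mono; rewrite eq_ij ltnn.
Qed.

Definition std w : 'S_n := perm (@rank_inj w).

Lemma stdE w j : std w j = rank w j :> nat.
Proof. by rewrite permE. Qed.

Lemma std_lt w i j : (std w i < std w j) = word_lt w i j.
Proof.
rewrite !stdE; apply/idP/idP => [|/rank_mono//].
case: (eqVneq i j) => [->|/(word_lt_total w)/orP[//|/rank_mono ji]].
  by rewrite ltnn.
by rewrite ltnNge (ltnW ji).
Qed.

Definition istd w : 'S_n := ((std w)^-1)%g.

Definition sorted_word w : {ffun 'I_n -> 'I_k} := [ffun x => w (istd w x)].

Lemma istd_lt w (x y : 'I_n) :
  (x < y) = (sorted_word w x < sorted_word w y)
            || ((sorted_word w x == sorted_word w y) && (istd w x < istd w y)).
Proof. by rewrite !ffunE -[in LHS](permKV (std w) x) -[in LHS](permKV (std w) y) std_lt. Qed.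

Definition std_stream w := stream (istd w) (sorted_word w).

Lemma std_stream0 w x : std_stream w x 0 = sorted_word w x.
Proof. by []. Qed.

Lemma std_streamS w x : (fun r => std_stream w x r.+1) = std_stream w (istd w x).
Proof. by apply/funext => r; rewrite /std_stream /stream iterSr. Qed.

(** By [istd_lt], cards are ordered by their first letter and then by their images under [istd w];
    iterating this gives the lexicographic order of prefixes. *)
Lemma std_stream_mono w t :
  {homo (fun x => code (std_stream w x) t) : x y / x <= y}.
Proof.
elim: t => [|t IHt] x y //=; rewrite leq_eqVlt => /orP[/eqP/val_inj -> //|].
rewrite (istd_lt w) !std_streamS !std_stream0 => /orP[lt_xy|/andP[/eqP -> lt_xy]]; last first.
  by rewrite leq_add2l IHt // ltnW.
apply: (@leq_trans ((sorted_word w x).+1 * k ^ t)).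
  by rewrite mulSnr leq_add2l ltnW // code_lt.
by rewrite (leq_trans _ (leq_addr _ _)) // leq_mul2r lt_xy orbT.
Qed.

Lemma istd_tie w (x y : 'I_n) :
  x < y -> std_stream w x = std_stream w y -> istd w x < istd w y.
Proof.
move=> lt_xy eq_xy; move: lt_xy; rewrite (istd_lt w) -!std_stream0 eq_xy ltnn eqxx.
by [].
Qed.

Lemma istd_iter_tie w (x y : 'I_n) p : x < y -> std_stream w x = std_stream w y ->
  iter p (istd w) x < iter p (istd w) y.
Proof.
move=> lt_xy eq_xy; elim: p => //= p IHp; apply: istd_tie => //.
exact: stream_iter_eq.
Qed.

(* A permutation moving x inside a level set of f, and increasing on that level
   set, would push x up (or down) forever. *)
Lemma increasing_fixpoint (B : Type) (f : 'I_n -> B) (s : 'S_n) x :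
  (forall y, f y = f x -> f (s y) = f x) ->
  (forall y z, f y = f x -> f z = f x -> y < z -> s y < s z) -> s x = x.
Proof.
move=> fs s_inc.
have f_iter t : f (iter t s x) = f x by elim: t => //= t; apply: fs.
have up t : x < s x -> iter t s x < iter t.+1 s x.
  by move=> lt_x; elim: t => //= t IHt; apply: s_inc => //; rewrite -?iterS.
have down t : s x < x -> iter t.+1 s x < iter t s x.
  by move=> lt_x; elim: t => //= t IHt; apply: s_inc => //; rewrite -?iterS.
have := iter_porbit s x; have := card_porbit_gt0 s x.
case: #|porbit s x| => // L _ xL; apply/val_inj => /=.
case: (ltngtP (s x) x) => // lt_x.
- have : iter L.+1 s x < x.
    by elim: L {xL} => [//|L IHL]; apply: ltn_trans IHL; apply: down.
  by rewrite xL ltnn.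
- have : x < iter L.+1 s x.
    by elim: L {xL} => [//|L IHL]; apply: (ltn_trans IHL); apply: up.
  by rewrite xL ltnn.
Qed.

(** Both families of streams are nondecreasing and one rearranges the other, so they agree card by
    card; only the behaviour of the two permutations inside ties is left. *)
Lemma std_stream_inj w w' (s : 'S_n) :
  (forall x, std_stream w' x = std_stream w (s x)) -> w' = w.
Proof.
move=> eq_s; have eqf x : std_stream w' x = std_stream w x.
  apply: code_inj => t.
  apply: (monotone_rearrangement (f := fun x => code (std_stream w' x) t)
    (g := fun x => code (std_stream w x) t) (s := s)).
  - exact: std_stream_mono.
  - exact: std_stream_mono.
  - by move=> y; rewrite eq_s.
have eqv x : sorted_word w' x = sorted_word w x by rewrite -!std_stream0 eqf.
have eq_step x : std_stream w (istd w' x) = std_stream w (istd w x).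
  by rewrite -eqf -!std_streamS eqf.
suff eq_istd x : istd w' x = istd w x.
  apply/ffunP => j; have := eqv (std w' j); rewrite !ffunE -eq_istd /istd.
  by rewrite permK.
(* [th] sends [istd w x] to [istd w' x]. It moves cards inside ties only, and keeps their order
   because [istd w] and [istd w'] are both increasing on ties; hence it is trivial. *)
pose th := ((istd w)^-1 * istd w')%g.
suff thE : th (istd w x) = istd w x by rewrite -[RHS]thE permM permK.
have thf y : std_stream w (th y) = std_stream w y.
  by rewrite -{2}(permKV (istd w) y) -eq_step permM.
apply: (increasing_fixpoint (f := std_stream w)) => [y <-//|y z fy fz].
rewrite -(permKV (istd w) y) -(permKV (istd w) z) !permM !permK in fy fz *.
move: (_ y) (_ z) fy fz => a b fa fb lt_ab.
have eq_ab : std_stream w a = std_stream w b.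
  by apply: stream_perm_inj; rewrite -/(std_stream _ _) fa -fb.
case: (ltngtP a b) lt_ab => [ab _|ba|/val_inj ->]; last by rewrite ltnn.
  by apply: istd_tie; rewrite ?eqf.
by move=> /(ltn_trans (istd_tie ba (esym eq_ab))); rewrite ltnn.
Qed.

(** Moving [d] steps along [istd w], with [d] the minimal period, permutes the cards tied with [x]
    and keeps their order, so it fixes [x]: the word read along a cycle is primitive. *)
Lemma min_period_std w x : min_period (std_stream w x) = #|porbit (istd w) x|.
Proof.
have [d_gt0 d_per d_min] := min_periodP (card_porbit_gt0 (istd w) x)
  (card_porbit_period (istd w) (sorted_word w) x).
apply/eqP; rewrite eqn_leq dvdn_leq ?card_porbit_gt0 //=; last first.
  exact/d_min/card_porbit_period.
apply: iter_fix_porbit => //; rewrite -permX; set d := min_period _.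
have fd y : std_stream w y = std_stream w x ->
    std_stream w (iter d (istd w) y) = std_stream w x.
  move=> yx; transitivity (std_stream w (iter d (istd w) x)).
    exact: stream_iter_eq.
  exact/stream_period.
apply: (increasing_fixpoint (f := std_stream w)) => [y yx|y z yx zx yz].
  by rewrite permX fd.
by rewrite !permX istd_iter_tie // yx zx.
Qed.

Definition tie_stab w := [set h : 'S_n | [forall x, `[< std_stream w (h x) = std_stream w x >]]].

Lemma tie_stabP w (h : 'S_n) :
  reflect (forall x, std_stream w (h x) = std_stream w x) (h \in tie_stab w).
Proof.
by rewrite inE; apply: (iffP forallP) => hf x; apply/asboolP; apply: hf.
Qed.

Lemma tie_stab_group w : group_set (tie_stab w).
Proof.
apply/group_setP; split=> [|g h /tie_stabP gf /tie_stabP hf].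
  by apply/tie_stabP => x; rewrite perm1.
by apply/tie_stabP => x; rewrite permM hf gf.
Qed.

Definition tie_group w := Group (tie_stab_group w).

Local Open Scope group_scope.

Definition coset_rep (g : 'S_n) w : 'S_n := repr (tie_group w :* g).

(* Conjugates the sorted word of w by a coset representative of the group of ties
   and spends the remaining factor of g inside that group: all n! values of g give
   distinct coloured permutations with the periodic words of w. *)
Definition spread (gw : 'S_n * {ffun 'I_n -> 'I_k}) : 'S_n * {ffun 'I_n -> 'I_k} :=
  let: (g, w) := gw in let t := coset_rep g w in
  ((istd w * (g * t^-1)) ^ t, [ffun x => sorted_word w (t^-1 x)]).

(** The factor [g * t^-1] lies in the group of ties, so inserting it after each step of [istd w]
    changes no letter read; conjugation by [t] only renames the cards. *)
Lemma spread_stream g w x :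
  stream (spread (g, w)).1 (spread (g, w)).2 x = std_stream w ((coset_rep g w)^-1 x).
Proof.
rewrite /spread /=; set t := coset_rep g w; set h := g * t^-1.
have /tie_stabP hf : h \in tie_stab w.
  have : h^-1 \in tie_group w.
    by rewrite /h invMg invgK -mem_rcoset; apply: (mem_repr_rcoset (tie_group w)).
  by rewrite groupV.
apply/funext => r; rewrite {1}/stream ffunE.
have -> : t^-1 (iter r ((istd w * h) ^ t) x) = iter r (istd w * h) (t^-1 x).
  by elim: r => //= r <-; rewrite conjgE !permM permK.
suff : std_stream w (iter r (istd w * h) (t^-1 x)) =
       std_stream w (iter r (istd w) (t^-1 x)).
  by move/(congr1 (fun f => f 0)).
elim: r => //= r IHr; rewrite permM hf.
exact: (stream_iter_eq 1 IHr).
Qed.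

(** The streams recover [w], then the coset of [g] and with it the representative; after cancelling
    these, [g] itself is left. *)
Lemma spread_inj : injective spread.
Proof.
move=> [g w] [g' w'] eq_gw.
have eq_st x : std_stream w ((coset_rep g w)^-1 x) =
               std_stream w' ((coset_rep g' w')^-1 x).
  by rewrite -!spread_stream eq_gw.
have eq_w : w' = w.
  apply: (std_stream_inj (s := coset_rep g' w' * (coset_rep g w)^-1)) => x.
  by rewrite permM eq_st permK.
subst w'; set t := coset_rep g w; set t' := coset_rep g' w.
have eq_t : t = t'.
  rewrite /t /t' /coset_rep; congr (repr _).
  rewrite -(rcoset_repr _ g) -(rcoset_repr _ g'); apply/rcoset_eqP.
  rewrite mem_rcoset; apply/tie_stabP => x; rewrite permM -/(coset_rep g' w).
  by rewrite -eq_st -/(coset_rep g w) permK.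
have := congr1 fst eq_gw; rewrite /= -/t -/t' eq_t => /conjg_inj /mulgI /mulIg -> //.
Qed.

End Standardization.

(** An injective self-map of a finite set is a bijection, so [spread] reindexes the sum over all
    coloured permutations, and each word accounts for the [n!] values of [g]. *)
Lemma sum_std_streams (n k : nat) (R : nmodType)
    (F : 'S_n -> {ffun 'I_n -> 'I_k} -> R) :
  (forall s (c w : {ffun 'I_n -> 'I_k}) (t : 'S_n), (forall x, stream s c x = std_stream w (t x)) ->
     F s c = F (istd w) (sorted_word w)) ->
  (\sum_s \sum_c F s c = (\sum_w F (istd w) (sorted_word w)) *+ n`!)%R.
Proof.
move=> F_inv; rewrite pair_big /= (reindex_inj (@spread_inj n k)) /=.
rewrite (eq_bigr (fun p => F (istd p.2) (sorted_word p.2))) => [|[g w] _] /=; last first.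
  exact/F_inv/spread_stream.
rewrite -(pair_big predT predT (fun (_ : 'S_n) w => F (istd w) (sorted_word w))) /=.
by rewrite GRing.sumr_const card_Sn.
Qed.

(** * Labelling the zeros *)

Lemma leq_card_inj_between (T : finType) (D : pred T) (f : T -> nat) a b :
  {in D &, injective f} -> #|[pred x in D | a <= f x < b]| <= b - a.
Proof.
move=> f_inj; rewrite cardE -(size_map f) -[X in _ <= X](size_iota a).
apply: uniq_leq_size.
  rewrite map_inj_in_uniq ?enum_uniq // => x y; rewrite !mem_enum !inE.
  by move=> /andP[xD _] /andP[yD _]; apply: f_inj.
move=> _ /mapP[x + ->]; rewrite mem_enum !inE mem_iota => /andP[_ /andP[ax xb]].
by rewrite ax subnKC // (leq_trans ax (ltnW xb)).
Qed.

(** At most [a] values lie below [a] and at most [#|D| - a] in the rest of the range, while the two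
    counts add up to [#|D|]. *)
Lemma card_inj_below (T : finType) (D : pred T) (f : T -> nat) a :
  {in D &, injective f} -> (forall x, x \in D -> f x < #|D|) -> a <= #|D| ->
  #|[pred x in D | f x < a]| = a.
Proof.
move=> f_inj f_lt a_le; apply/eqP; rewrite eqn_leq.
have -> /= : #|[pred x in D | f x < a]| <= a.
  by have := leq_card_inj_between 0 a f_inj; rewrite subn0.
rewrite -(leq_add2r (#|D| - a)) subnKC // -{1}(cardID [pred x | f x < a] D).
have -> : #|[pred x in D | f x < a]| = #|[predI D & [pred x | f x < a]]|.
  by apply: eq_card => x; rewrite !inE.
rewrite leq_add2l; apply: leq_trans (leq_card_inj_between a #|D| f_inj).
apply/subset_leq_card/fintype.subsetP => x; rewrite !inE -leqNgt.
by move=> /andP[-> xD]; rewrite f_lt ?andbT.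
Qed.

Lemma card_perm_below n (s : 'S_n) a : a <= n -> #|[pred i | s i < a]| = a.
Proof.
move=> a_le; transitivity #|[pred i in 'I_n | s i < a]|; first exact: eq_card.
apply: (card_inj_below (D := predT) (f := fun i => s i)); rewrite ?card_ord //.
by move=> i j _ _ /val_inj/perm_inj.
Qed.

Section LabelledZeros.
Variables n q : nat.
Implicit Types (w c : {ffun 'I_n -> 'I_q.+1}) (b : {ffun 'I_n -> 'I_(n + q)}).

(* The letter 0 is split into the distinct letters 0, ..., n - 1, all smaller
   than the nonzero letters. *)
Definition collapse_letter (l : 'I_(n + q)) : 'I_q.+1 :=
  if fintype.split l is inr a then lift ord0 a else ord0.

Definition collapse b : {ffun 'I_n -> 'I_q.+1} := [ffun j => collapse_letter (b j)].

Definition refine w (s : 'S_n) : {ffun 'I_n -> 'I_(n + q)} :=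
  [ffun j => if unlift ord0 (w j) is Some a then rshift n a else lshift q (s j)].

Definition zeros c := [pred x | c x == ord0].

(** The labels of the [m] zeros are distinct and below [m], hence exactly [0, ..., m - 1]: the cards
    that a shuffle places under the zeros. *)
Definition labelled b :=
  [forall x in zeros (collapse b), b x < #|zeros (collapse b)|]
  && [forall x in zeros (collapse b), forall y, (b x == b y) ==> (x == y)].

(** Mirrors [written_under]: without negative letters the block of 0 is the lowest one and starts at
    card 0. *)
Definition word_compatible w (s : 'S_n) :=
  [forall j, if w j == ord0 then s j < #|zeros w| else s j == rank w j :> nat].

Lemma collapse_letter_eq0 l : (collapse_letter l == ord0) = (l < n).
Proof.
rewrite /collapse_letter; case: fintype.splitP => [j _|a _]; first by rewrite eqxx.
by apply/negbTE; rewrite eq_sym neq_lift.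
Qed.

Lemma collapse_zeros b x : (x \in zeros (collapse b)) = (b x < n).
Proof. by rewrite inE ffunE collapse_letter_eq0. Qed.

Lemma collapse_letter_val (l : 'I_(n + q)) : n <= l -> l = n + (collapse_letter l).-1 :> nat.
Proof.
rewrite /collapse_letter; case: fintype.splitP => [j ->|a -> _]; first by rewrite leqNgt ltn_ord.
by rewrite lift0.
Qed.

Lemma collapse_refine w s : collapse (refine w s) = w.
Proof.
apply/ffunP => j; rewrite !ffunE /collapse_letter.
by case: unliftP => [a ->|->]; rewrite ?(unsplitK (inr _ a)) ?(unsplitK (inl _ _)).
Qed.

Lemma refine_collapse b (s : 'S_n) : (forall j, b j < n -> b j = s j :> nat) ->
  refine (collapse b) s = b.
Proof.
move=> bs; apply/ffunP => j; apply/val_inj; rewrite !ffunE.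
case: unliftP => [a|] bj /=.
  have : ~~ (b j < n) by rewrite -collapse_letter_eq0 bj eq_sym neq_lift.
  by rewrite -leqNgt => /collapse_letter_val ->; rewrite bj lift0.
by rewrite bs // -collapse_letter_eq0 bj.
Qed.

(** Labels of zeros stay below [n], hence below all nonzero letters, so splitting 0 does not affect
    a comparison with a nonzero letter. *)
Lemma word_lt_collapse b i j : n <= b j -> word_lt b i j = word_lt (collapse b) i j.
Proof.
move=> bj; rewrite /word_lt !ffunE -(inj_eq val_inj) -[in RHS](inj_eq val_inj) /=.
have vj := collapse_letter_val bj.
have cj : 0 < collapse_letter (b j).
  by rewrite lt0n; apply: contraTN bj => cj; rewrite -ltnNge -collapse_letter_eq0.
case: (ltnP (b i) n) => bi.
  have /eqP -> : collapse_letter (b i) == ord0 by rewrite collapse_letter_eq0.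
  by rewrite (leq_trans bi bj) cj.
have vi := collapse_letter_val bi.
have ci : 0 < collapse_letter (b i).
  by rewrite lt0n; apply: contraTN bi => ci; rewrite -ltnNge -collapse_letter_eq0.
rewrite vi vj ltn_add2l eqn_add2l -ltnS !prednK //; congr (_ || (_ && _)).
by rewrite -[in RHS](prednK ci) -[in RHS](prednK cj) eqSS.
Qed.

Lemma rank_collapse b j : n <= b j -> rank b j = rank (collapse b) j.
Proof. by move=> bj; apply: eq_card => i; rewrite !inE word_lt_collapse. Qed.

Lemma refine_lt w s j : (refine w s j < n) = (w j == ord0).
Proof. by rewrite -[in RHS](collapse_refine w s) -[RHS]/(j \in zeros _) collapse_zeros. Qed.

Lemma refine_val w s j : w j = ord0 -> refine w s j = s j :> nat.
Proof. by move=> wj; rewrite ffunE wj unlift_none. Qed.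

Lemma compatible_zero w s j : word_compatible w s ->
  (s j < #|zeros w|) = (w j == ord0).
Proof.
move=> /forallP/(_ j); case: eqP => // /eqP wj /eqP ->; apply/negbTE.
rewrite -leqNgt; apply/subset_leq_card/fintype.subsetP => i; rewrite !inE.
by rewrite /word_lt => /eqP ->; rewrite lt0n wj.
Qed.

(** At a zero [j], the positions preceding [j] are those carrying a card below [s j], and there are
    [s j] of them; elsewhere splitting 0 leaves the rank unchanged. *)
Lemma std_refine w s : word_compatible w s -> std (refine w s) = s.
Proof.
move=> ws; apply/permP => j; apply/val_inj; rewrite /= stdE.
have := forallP ws j; case: eqP => [wj _|/eqP wj /eqP ->]; last first.
  by rewrite rank_collapse ?collapse_refine // leqNgt refine_lt.
rewrite -[RHS](@card_perm_below _ s) ?(ltnW (ltn_ord _)) //; apply: eq_card => i.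
rewrite !inE /word_lt -(inj_eq val_inj) /= (refine_val s wj).
case: (eqVneq (w i) ord0) => wi.
  rewrite (refine_val s wi); case: ltngtP => //= /val_inj/perm_inj ->.
  by rewrite ltnn.
have n_le : n <= refine w s i by rewrite leqNgt refine_lt.
have lt_n := leq_trans (ltn_ord (s j)) n_le.
rewrite ltnNge (ltnW lt_n) gtn_eqF //=; apply/esym/negbTE; rewrite -leqNgt ltnW //.
have : s j < #|zeros w| by rewrite compatible_zero // wj.
by move=> /leq_trans; apply; rewrite leqNgt compatible_zero.
Qed.

Lemma labelledP b :
  reflect ((forall x, b x < n -> b x < #|zeros (collapse b)|) /\
           (forall x y, b x < n -> b x = b y -> x = y)) (labelled b).
Proof.
apply: (iffP andP) => -[b_lt b_inj]; split.
- by move=> x xz; have := forallP b_lt x; rewrite collapse_zeros xz.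
- move=> x y xz xy; apply/eqP; have := forallP b_inj x.
  rewrite collapse_zeros xz => /forallP/(_ y); by rewrite xy eqxx.
- by apply/forallP => x; apply/implyP; rewrite collapse_zeros; apply: b_lt.
apply/forallP => x; apply/implyP; rewrite collapse_zeros => xz.
by apply/forallP => y; apply/implyP => /eqP /(b_inj _ _ xz) ->.
Qed.

Lemma rank_labelled b j : labelled b -> b j < n -> rank b j = b j.
Proof.
move=> /labelledP[b_lt b_inj] bj.
rewrite -[RHS](@card_inj_below _ (zeros (collapse b)) (fun x => b x)).
- apply: eq_card => i; rewrite /word_lt !inE -[b i == b j](inj_eq val_inj) /=.
  rewrite -[_ == ord0]/(i \in zeros (collapse b)) collapse_zeros.
  case: (ltngtP (b i) (b j)) => [lt_ij|_|eq_ij]; rewrite ?andbF ?andbT //=.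
    by rewrite (ltn_trans lt_ij).
  by rewrite (b_inj i j) ?ltnn // ?eq_ij //; apply: val_inj.
- by move=> x y; rewrite collapse_zeros => xz _ /val_inj; apply: b_inj.
- by move=> x; rewrite collapse_zeros; apply: b_lt.
- exact/ltnW/b_lt.
Qed.

Lemma compatible_std b : labelled b -> word_compatible (collapse b) (std b).
Proof.
move=> b_lab; apply/forallP => j; have := collapse_zeros b j; rewrite inE => ->.
case: ltnP => bj; rewrite stdE; last by rewrite rank_collapse.
by rewrite rank_labelled //; have /labelledP[b_lt _] := b_lab; apply: b_lt.
Qed.

Lemma labelled_refine w s : word_compatible w s -> labelled (refine w s).
Proof.
move=> ws; apply/labelledP; rewrite collapse_refine; split=> [x|x y].
  by rewrite refine_lt => /eqP wx; rewrite refine_val // compatible_zero // wx.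
rewrite refine_lt => /eqP wx /(congr1 val) /= eq_xy.
have wy : w y = ord0 by apply/eqP; rewrite -(refine_lt w s) -eq_xy refine_lt wx.
by move: eq_xy; rewrite !refine_val // => /val_inj/perm_inj.
Qed.

Lemma sum_compatible (R : nmodType) w (F : 'S_n -> R) :
  (\sum_(s | word_compatible w s) F s =
   \sum_(b | labelled b && (collapse b == w)) F (std b))%R.
Proof.
rewrite (reindex_onto (@std n (n + q)) (refine w)) => [|s]; last exact: std_refine.
apply: eq_bigl => b; apply/andP/andP => [[ws /eqP <-]|[b_lab /eqP <-]].
  by rewrite labelled_refine // collapse_refine.
rewrite compatible_std // refine_collapse // => j bj.
by rewrite stdE rank_labelled.
Qed.

(** Labelled words over [c] are the injections of its [m] zeros into the first [m] labels; their
    number cancels the division by [m!] in the shuffle. *)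
Lemma card_labelled c : #|[pred b | labelled b && (collapse b == c)]| = (#|zeros c|)`!.
Proof.
pose Z := {x : 'I_n | c x == ord0}; set m := #|zeros c|.
have cardZ : #|{: Z}| = m by rewrite card_sig; apply: eq_card.
have m_le : m <= n by rewrite -[X in _ <= X]card_ord max_card.
have card_m : #|[pred l : 'I_(n + q) | l < m]| = m.
  rewrite -[RHS](@card_perm_below (n + q) 1%g m (leq_trans m_le (leq_addr _ _))).
  by apply: eq_card => l; rewrite !inE perm1.
have := card_inj_ffuns_on Z [pred l : 'I_(n + q) | l < m].
rewrite card_m cardZ ffactnn => <-; rewrite -[LHS]sum1_card -[RHS]sum1_card.
pose ext (f : {ffun Z -> 'I_(n + q)}) : {ffun 'I_n -> 'I_(n + q)} :=
  [ffun x => if insub x is Some z then f z else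
             if unlift ord0 (c x) is Some a then rshift n a else lshift q x].
pose res b : {ffun Z -> 'I_(n + q)} := [ffun z => b (val z)].
have extE f (z : Z) : ext f (val z) = f z by rewrite ffunE valK.
have extK f : res (ext f) = f by apply/ffunP => z; rewrite ffunE extE.
have ext_nz f x : c x != ord0 -> exists2 a, c x = lift ord0 a & ext f x = rshift n a.
  move=> cx; rewrite ffunE insubN //; case: unliftP cx => [a ->|->]; last by rewrite eqxx.
  by exists a.
rewrite (reindex_onto ext res) => [|b]; last first.
  rewrite inE => /andP[_ /eqP cb]; apply/ffunP => x; rewrite ffunE.
  case: insubP => [z _ <-|cx]; first by rewrite ffunE.
  case: unliftP cx => [a|->]; last by rewrite eqxx.
  rewrite -cb ffunE => bx _; apply/val_inj => /=.
  have : ~~ (b x < n) by rewrite -collapse_letter_eq0 bx eq_sym neq_lift.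
  by rewrite -leqNgt => /collapse_letter_val ->; rewrite bx lift0.
apply: eq_bigl => f; rewrite !inE extK eqxx andbT.
apply/andP/andP => [[/labelledP[b_lt b_inj] /eqP cE]|[/ffun_onP f_on /injectiveP f_inj]].
  have lt_f (z : Z) : ext f (val z) < n.
    by rewrite -collapse_zeros cE inE (valP z).
  split; first by apply/ffun_onP => z; have := b_lt _ (lt_f z); rewrite inE extE cE.
  apply/injectiveP => y z; rewrite -!extE => yz; apply/val_inj.
  exact: b_inj (lt_f y) yz.
have f_lt z : f z < m by apply: f_on.
have cE : collapse (ext f) = c.
  apply/ffunP => x; rewrite ffunE; case: (eqVneq (c x) ord0) => [cx|/(ext_nz f)[a -> ->]].
    apply/eqP; rewrite cx collapse_letter_eq0 -[x]/(val (Sub x (introT eqP cx) : Z)).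
    by rewrite extE (leq_trans (f_lt _)).
  by rewrite /collapse_letter (unsplitK (inr _ a)).
rewrite cE eqxx; split=> //; apply/labelledP; rewrite cE.
have zE x : ext f x < n -> exists z : Z, x = val z.
  by rewrite -collapse_zeros cE inE => cx; exists (Sub x cx).
split=> [x /zE[z ->]|x y xz]; first by rewrite extE.
move=> xy; have yz := xz; rewrite xy in yz.
by case/zE: xz xy => x' ->; case/zE: yz => y' ->; rewrite !extE => /f_inj ->.
Qed.


Lemma card_comp_perm (P : pred 'I_n) (t : 'S_n) : #|[pred x | P (t x)]| = #|P|.
Proof.
rewrite -[RHS](on_card_preimset (f := t)); first by apply: eq_card => x; rewrite !inE.
by apply: onW_bij; exists (t^-1)%g; [apply: permK | apply: permKV].
Qed.

Lemma labelled_comp b b' (t : 'S_n) :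
  (forall x, b' x = b (t x)) -> labelled b' = labelled b.
Proof.
move=> b't; have zE : #|zeros (collapse b')| = #|zeros (collapse b)|.
  rewrite -[RHS](card_comp_perm _ t); apply: eq_card => x.
  by rewrite !inE !ffunE b't.
apply/labelledP/labelledP; rewrite zE => -[b_lt b_inj]; split.
- by move=> x; have := b_lt ((t^-1)%g x); rewrite b't permKV.
- move=> x y; have := b_inj ((t^-1)%g x) ((t^-1)%g y); rewrite !b't !permKV.
  by move=> xy ? ?; apply: (@perm_inj _ (t^-1)%g); apply: xy.
- by move=> x; rewrite b't; apply: b_lt.
by move=> x y; rewrite !b't => bx /(b_inj _ _ bx)/perm_inj.
Qed.

(* Labelled zeros are pairwise distinct, so a periodic word meeting a zero has no
   period shorter than its cycle. *)
Definition mark (s : 'S_n) c x : nat :=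
  if [exists y in porbit s x, c y == ord0] then #|porbit s x|
  else min_period (stream s c x).

Lemma mark_labelled s b x : labelled b ->
  mark s (collapse b) x = min_period (stream s b x).
Proof.
move=> /labelledP[_ b_inj]; rewrite /mark; case: ifPn => [/exists_inP[y]|no_zero].
  rewrite -[_ == _]/(y \in zeros (collapse b)) collapse_zeros => /porbitP[i yE] yz.
  have [d_gt0 d_per d_min] := min_periodP (card_porbit_gt0 s x)
    (card_porbit_period s b x).
  apply/eqP; rewrite eqn_leq [X in _ && X]dvdn_leq ?card_porbit_gt0 //; last first.
    exact/d_min/card_porbit_period.
  rewrite andbT; apply: iter_fix_porbit => //; set d := min_period _ in d_per *.
  rewrite permX in yE; have := d_per i; rewrite /stream -yE => /esym /(b_inj _ _ yz).
  by rewrite yE iterD -[LHS]permX -[RHS]permX => /perm_inj/esym.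
apply: eq_min_period => p.
have nz r : n <= b (iter r s x).
  rewrite leqNgt -collapse_zeros; apply: contra no_zero => zr.
  by apply/exists_inP; exists (iter r s x); rewrite // -permX mem_porbit.
split=> per r; have := per r; rewrite /stream ?ffunE; last by move=> ->.
move=> eq_r; apply: val_inj => /=.
by rewrite (collapse_letter_val (nz _)) eq_r -(collapse_letter_val (nz _)).
Qed.

End LabelledZeros.

Definition level_card (T : finType) (f : T -> nat) : nat -> nat :=
  fun i => #|[pred x | f x == i]|.

(** Cycle lengths of the shuffle are minimal periods of the streams of a labelled word, and
    [sum_std_streams] carries these to arbitrary coloured permutations, where they become marks.
    Symmetry of [W] gives a sorted word the weight of the word it comes from. *)
Lemma sum_compatible_words (R : numFieldType) (n q : nat)
    (W : {ffun 'I_n -> 'I_q.+1} -> R) (F : (nat -> nat) -> R) :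
  (forall (c : {ffun 'I_n -> 'I_q.+1}) (t : 'S_n), W [ffun x => c (t x)] = W c) ->
  ((\sum_w \sum_(s | word_compatible w s)
      W w / ((#|zeros w|)`!)%:R * F (level_card (fun x => #|porbit s x|))) *+ n`! =
   \sum_(s : 'S_n) \sum_c W c * F (level_card (mark s c)))%R.
Proof.
move=> W_inv; pose V b : R := (W (collapse b) / ((#|zeros (collapse b)|)`!)%:R)%R.
pose Phi (s : 'S_n) b : R := (if labelled b then
  V b * F (level_card (fun x => min_period (stream s b x))) else 0)%R.
have group_collapse (G : {ffun 'I_n -> 'I_(n + q)} -> R) :
    (\sum_b (if labelled b then G b else 0) =
     \sum_w \sum_(b | labelled b && (collapse b == w)) G b)%R.
  rewrite -big_mkcond (partition_big (@collapse n q) predT) //=.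
transitivity ((\sum_b Phi (istd b) (sorted_word b)) *+ n`!)%R.
  congr (_ *+ _)%R; rewrite (eq_bigr (fun b => if labelled b then
      V b * F (level_card (fun x => #|porbit (std b) x|)) else 0)%R) => [|b _].
    rewrite group_collapse; apply: eq_bigr => w _; rewrite sum_compatible.
    by apply: eq_bigr => b /andP[_ /eqP cb]; rewrite /V cb.
  have sE x : sorted_word b x = b (istd b x) by rewrite ffunE.
  rewrite /Phi (labelled_comp sE); case: ifP => // _; congr (_ * F _)%R.
    have cE : collapse (sorted_word b) = [ffun x => collapse b (istd b x)].
      by apply/ffunP => x; rewrite !ffunE.
    rewrite /V cE W_inv; congr (_ / (_`!)%:R)%R.
    by rewrite -[RHS](card_comp_perm _ (istd b)); apply: eq_card => x; rewrite !inE !ffunE.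
  apply/funext => i; apply: eq_card => x; rewrite !inE.
  by rewrite -/(std_stream b x) min_period_std porbitV.
rewrite -sum_std_streams => [|s b w t st]; last first.
  have bt x : b x = sorted_word w (t x) by have := congr1 (fun f => f 0) (st x).
  rewrite /Phi (labelled_comp bt); case: ifP => // _; congr (_ * F _)%R.
    have cE : collapse b = [ffun x => collapse (sorted_word w) (t x)].
      by apply/ffunP => x; rewrite !ffunE bt ffunE.
    rewrite /V cE W_inv; congr (_ / (_`!)%:R)%R.
    by rewrite -[RHS](card_comp_perm _ t); apply: eq_card => x; rewrite !inE !ffunE.
  apply/funext => i; rewrite /level_card -[RHS](card_comp_perm _ t).
  by apply: eq_card => x; rewrite !inE st.
apply: eq_bigr => s _; rewrite /Phi group_collapse; apply: eq_bigr => c _.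
rewrite (eq_bigr (fun=> W c / ((#|zeros c|)`!)%:R * F (level_card (mark s c)))%R).
  by rewrite GRing.sumr_const card_labelled -[LHS]GRing.mulr_natr GRing.mulrAC GRing.divfK.
move=> b /andP[b_lab /eqP cb]; rewrite /V cb; congr (_ * F _)%R.
apply/funext => i; apply: eq_card => x; rewrite !inE -cb.
by rewrite mark_labelled.
Qed.

(** * Removing a cycle of a coloured permutation *)

Import Order.TTheory GRing.Theory Num.Theory.
Local Open Scope ring_scope.

Section ProductMeasure.
Variables (R : comPzRingType) (T A : finType) (p : A -> R).
Hypothesis p_sum1 : \sum_a p a = 1.

Definition weight (I : finType) (c : {ffun I -> A}) : R := \prod_x p (c x).

Lemma weight_sum1 (I : finType) : \sum_(c : {ffun I -> A}) weight c = 1.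
Proof. by rewrite -(bigA_distr_bigA (fun _ j => p j)) big1. Qed.

(** The right side is a sum over two independent copies. Exchanging their letters outside [D]
    preserves the joint weight and makes [f] and [g] read the same copy. *)
Lemma weight_indep (D : {pred T}) (f g : {ffun T -> A} -> R) :
  (forall c c' : {ffun T -> A}, {in D, c =1 c'} -> f c = f c') ->
  (forall c c' : {ffun T -> A}, {in [predC D], c =1 c'} -> g c = g c') ->
  \sum_c weight c * (f c * g c) = (\sum_c weight c * f c) * (\sum_c weight c * g c).
Proof.
move=> fD gD; pose mix (c c' : {ffun T -> A}) : {ffun T -> A} :=
  [ffun x => if x \in D then c x else c' x].
pose sw (cc : {ffun T -> A} * {ffun T -> A}) := (mix cc.1 cc.2, mix cc.2 cc.1).
have swK : involutive sw.
  by move=> [c c']; congr (_, _); apply/ffunP => x; rewrite /= !ffunE; case: (x \in D).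
rewrite big_distrl /=; under [RHS]eq_bigr do rewrite big_distrr /=.
rewrite pair_big /= (reindex_inj (inv_inj swK)) /=.
rewrite -[LHS]mulr1 -(weight_sum1 T) big_distrl /=.
under [LHS]eq_bigr do rewrite big_distrr /=.
rewrite pair_big /=; apply: eq_bigr => -[c c'] _ /=.
have -> : f (mix c c') = f c by apply: fD => x xD; rewrite ffunE xD.
have -> : g (mix c' c) = g c.
  by apply: gD => x; rewrite inE ffunE => /negbTE ->.
have ww : weight (mix c c') * weight (mix c' c) = weight c * weight c'.
  rewrite -!big_split; apply: eq_bigr => x _ /=; rewrite !ffunE.
  by case: ifP => // _; rewrite mulrC.
by rewrite mulrACA ww mulrAC.
Qed.

(** With the letters on the image of [y] fixed, the free letters sum to 1 coordinate by
    coordinate. *)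
Lemma weight_marginal (I : finType) (y : I -> T) (h : {ffun I -> A} -> R) :
  injective y ->
  \sum_c weight c * h [ffun t => c (y t)] = \sum_(a : {ffun I -> A}) weight a * h a.
Proof.
move=> y_inj.
rewrite (partition_big (fun c : {ffun T -> A} => [ffun t => c (y t)]) predT) //=.
apply: eq_bigr => a _; rewrite (eq_bigr (fun c => weight c * h a)); last first.
  by move=> c /eqP ->.
rewrite -big_distrl /=; congr (_ * _).
(* [Q x] is the set of letters allowed at [x]: a prescribed one on the image of [y], all letters
   elsewhere. *)
pose Q x : pred A := [pred j | [forall t, (y t == x) ==> (a t == j)]].
rewrite (eq_bigl (mem (family Q))) => [|c]; last first.
  apply/eqP/familyP => [ca x|cQ].
    by rewrite inE -ca; apply/forallP => t; apply/implyP => /eqP <-; rewrite ffunE.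
  apply/ffunP => t; rewrite ffunE; have := cQ (y t); rewrite inE.
  by move=> /forallP/(_ t); rewrite eqxx => /eqP.
rewrite /weight -(bigA_distr_big_dep Q (fun _ j => p j)) (bigID (mem (codom y))) /=.
rewrite [X in _ * X]big1 => [|x xy]; last first.
  rewrite -p_sum1; apply: eq_bigl => j; apply/forallP => t.
  by apply/implyP => /eqP yx; rewrite -yx codom_f in xy.
rewrite mulr1 -big_uniq /=; last by rewrite map_inj_uniq ?enum_uniq.
rewrite big_map big_enum /=; apply: eq_bigr => t _.
rewrite (big_pred1 (a t)) // => j; apply/forallP/eqP => [/(_ t)|-> t'].
  by rewrite eqxx => /eqP.
by apply/implyP => /eqP/y_inj ->.
Qed.

End ProductMeasure.

Section CycleRemoval.
Variables n q : nat.
Implicit Types (s : 'S_n) (c : {ffun 'I_n -> 'I_q.+1}) (S : {set 'I_n}).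

Lemma eq_mark s s' c x :
  (forall r, iter r s x = iter r s' x) -> mark s c x = mark s' c x.
Proof.
move=> ss'; have st : stream s c x = stream s' c x.
  by apply/funext => r; rewrite /stream ss'.
have porb : porbit s x = porbit s' x.
  by apply/setP => y; apply/porbitP/porbitP => -[r ->]; exists r; rewrite !permX ss'.
by rewrite /mark st porb.
Qed.

Lemma mark_step s c x : mark s c (s x) = mark s c x.
Proof.
have porb : porbit s (s x) = porbit s x by have := porbit_perm s 1 x; rewrite expg1.
rewrite /mark porb; case: ifP => // _; apply: eq_min_period => p.
rewrite !stream_period -iterSr iterS.
by split=> [/stream_perm_inj|/(stream_iter_eq 1)].
Qed.

Lemma mark_iter s c x r : mark s c (iter r s x) = mark s c x.
Proof. by elim: r => //= r IHr; rewrite mark_step. Qed.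

(** The mark of a cycle as a function of the letters read along it; the index [l] stands for length
    [l.+1], cycles being nonempty. *)
Definition word_mark l (a : {ffun 'I_l.+1 -> 'I_q.+1}) : nat :=
  if [exists t, a t == ord0] then l.+1 else min_period (fun r => a (inZp r)).

Lemma mark_word s c x l : #|porbit s x| = l.+1 ->
  mark s c x = word_mark [ffun t : 'I_l.+1 => c (iter t s x)].
Proof.
move=> xl; have modx r : iter (r %% l.+1) s x = iter r s x.
  have xlm m : iter (m * l.+1) s x = x.
    by elim: m => // m IHm; rewrite mulSn iterD IHm -xl iter_porbit.
  by rewrite [in RHS](divn_eq r l.+1) addnC iterD xlm.
rewrite /mark /word_mark; congr (if _ then _ else _); last first.
- by congr min_period; apply/funext => r; rewrite ffunE /= modx.
- by [].
apply/exists_inP/existsP => [[y /porbitP[r ->] cy]|[t]]; last first.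
  by rewrite ffunE => ct; exists (iter t s x); rewrite // -permX mem_porbit.
by exists (inZp r); rewrite ffunE /= modx -permX.
Qed.

Lemma word_mark_dvd l (a : {ffun 'I_l.+1 -> 'I_q.+1}) : (word_mark a %| l.+1)%N.
Proof.
rewrite /word_mark; case: ifP => // _.
suff per : is_period (fun r => a (inZp r)) l.+1 by have [] := min_periodP _ per; auto.
by move=> t; congr (a _); apply/val_inj; rewrite /= modnDr.
Qed.

Definition mark_count S s c i := #|[pred x in S | mark s c x == i]|.

Lemma mark_gt0 s c x : (0 < mark s c x)%N.
Proof.
rewrite (mark_word c (esym (prednK (card_porbit_gt0 s x)))).
exact: dvdn_gt0 (word_mark_dvd _).
Qed.

Section FixedCycle.
Variables (S : {set 'I_n}) (x0 : 'I_n) (l : nat) (t : l.-tuple 'I_n).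
Hypotheses (Sx0 : x0 \in S) (tS : all (mem (S :\ x0)) t) (t_uniq : uniq t).

Let y := x0 :: t.

Lemma cycle_uniq : uniq y.
Proof.
rewrite /= t_uniq andbT; apply/negP => /(allP tS); rewrite !inE eqxx //.
Qed.

Definition cycle_perm : 'S_n := perm (can_inj (prev_next cycle_uniq)).

Definition cycle_compl : {set 'I_n} := S :\: [set x in y].

Lemma cycle_sub : {subset y <= S}.
Proof. by move=> x; rewrite inE => /orP[/eqP ->//|/(allP tS)]; rewrite !inE => /andP[]. Qed.

Lemma card_cycle_compl : #|cycle_compl| = (#|S| - l.+1)%N.
Proof.
have yS : [set x in y] \subset S by apply/fintype.subsetP => x; rewrite inE => /cycle_sub.
by rewrite cardsD (finset.setIidPr yS) cardsE (card_uniqP cycle_uniq) /= size_tuple.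
Qed.

Lemma cycle_compl_mem x : (x \in cycle_compl) = (x \in S) && (x \notin y).
Proof. by rewrite inE andbC inE. Qed.

Section Glue.
Variable s' : 'S_n.
Hypothesis s'_on : s' \in Sym cycle_compl.
Let s : 'S_n := (cycle_perm * s')%g.

Let s'_perm_on : perm_on cycle_compl s'.
Proof. by move: s'_on; rewrite inE. Qed.

Lemma glue_in x : x \in y -> s x = next y x.
Proof.
move=> xy; rewrite permM permE.
by apply: (out_perm s'_perm_on); rewrite cycle_compl_mem mem_next xy andbF.
Qed.

Lemma glue_out x : x \notin y -> s x = s' x.
Proof. by move=> xy; rewrite permM permE next_nth (negbTE xy). Qed.

Lemma glue_traject : traject s x0 l.+1 = y /\ iter l.+1 s x0 = x0.
Proof.
have : path (frel s) x0 (rcons t x0).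
  have := cycle_next cycle_uniq; rewrite /= => cy.
  rewrite (eq_in_path (P := mem y) (e' := frel (next y))) //.
    by move=> a b ay _ /=; rewrite glue_in.
  by apply/allP => z; rewrite inE mem_rcons -/y => /orP[/eqP ->|//]; apply: mem_head.
move=> /fpathP[k]; have [->|k_gt0] := posnP k; first by case: (tval t).
move=> tx; have kE : k = l.+1.
  by have := congr1 size tx; rewrite size_rcons size_traject size_tuple.
move: tx; rewrite kE trajectSr => /rcons_inj[tE xE]; split.
  by rewrite trajectS /y tE.
by rewrite iterSr -xE.
Qed.

Lemma glue_porbit : #|porbit s x0| = l.+1.
Proof.
have [tr it] := glue_traject; apply/eqP; rewrite eqn_leq iter_fix_porbit //=.
have <- : size y = l.+1 by rewrite /= size_tuple.
rewrite -(card_uniqP cycle_uniq); apply/subset_leq_card/fintype.subsetP => x.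
by rewrite -tr => /trajectP[r _ ->]; rewrite -permX mem_porbit.
Qed.

Lemma glue_Sym : s \in Sym S.
Proof.
rewrite inE; apply/fintype.subsetP => x; rewrite inE; apply: contraR => xS.
have xy : x \notin y by apply: contra xS => /cycle_sub.
rewrite glue_out //; apply/eqP/(out_perm s'_perm_on).
by rewrite cycle_compl_mem (negbTE xS).
Qed.

Lemma glue_iter_compl x r : x \in cycle_compl -> iter r s x = iter r s' x.
Proof.
move=> xC; elim: r => //= r ->; rewrite glue_out //.
have : iter r s' x \in cycle_compl.
  by elim: r => //= r IHr; rewrite (perm_closed _ s'_perm_on).
by rewrite cycle_compl_mem => /andP[].
Qed.

Lemma glue_mark_count c i : mark_count S s c i =
  ((mark s c x0 == i) * l.+1 + mark_count cycle_compl s' c i)%N.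
Proof.
rewrite /mark_count -(cardID (mem y)); congr (_ + _)%N; last first.
  apply: eq_card => x; rewrite !inE -!andbA /=.
  rewrite -[(x == x0) || _]/(x \in y); case: (boolP (x \in cycle_compl)).
    by move=> xC; rewrite (eq_mark c (fun r => glue_iter_compl r xC)).
  rewrite cycle_compl_mem negb_and negbK => /orP[/negbTE ->|->//].
  by rewrite ?andbF.
have markE x : x \in y -> mark s c x = mark s c x0.
  by have [<- _] := glue_traject => /trajectP[r _ ->]; rewrite mark_iter.
case: eqP => [mi|mi]; last first.
  rewrite mul0n; apply: eq_card0 => x; rewrite !inE; apply/negP.
  by move=> /andP[/andP[_ /eqP xi] xy]; apply: mi; rewrite -xi markE ?inE.
have sz : size y = l.+1 by rewrite /= size_tuple.
rewrite mul1n -sz -[RHS](card_uniqP cycle_uniq); apply: eq_card => x; rewrite !inE /=.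
rewrite -[(x == x0) || _]/(x \in y); case: (boolP (x \in y)) => xy; rewrite ?andbF //.
by rewrite cycle_sub // markE // mi eqxx.
Qed.

End Glue.

(** Once the cycle of [x0] is prescribed to be [x0 :: t], the rest is a free permutation of the
    remaining points. *)
Lemma glue_cond s' : [&& (cycle_perm * s')%g \in Sym S,
    #|porbit (cycle_perm * s')%g x0| == l.+1 &
    traject (cycle_perm * s')%g ((cycle_perm * s')%g x0) l == t] =
  (s' \in Sym cycle_compl).
Proof.
set s := (_ * _)%g; apply/idP/idP => [/and3P[sS /eqP xl /eqP st]|s'_on]; last first.
  rewrite glue_Sym // glue_porbit // eqxx /=.
  by have [tr _] := glue_traject s'_on; move: tr; rewrite trajectS => -[->].
rewrite inE in sS.
have cyc : fcycle s y.
  have -> : fcycle s y = fpath s x0 (rcons (traject s (s x0) l) (iter l s (s x0))).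
    by rewrite -iterSr -xl iter_porbit /y /= st.
  by rewrite -trajectSr fpath_traject.
have s'_fix x : x \in y -> s' (next y x) = next y x.
  by move=> xy; have /eqP e := next_cycle cyc xy; rewrite -[RHS]e permM permE.
rewrite inE; apply/fintype.subsetP => z; rewrite inE; apply: contraR.
rewrite cycle_compl_mem negb_and negbK => zC.
case: (boolP (z \in y)) zC => [zy _|zy]; last first.
  rewrite orbF => zS; have := out_perm sS zS.
  by rewrite permM permE next_nth (negbTE zy) => ->.
have <- : next y (prev y z) = z by apply: next_prev cycle_uniq z.
by rewrite s'_fix // mem_prev.
Qed.

End FixedCycle.

End CycleRemoval.

(** There are [k ^_ l] ordered choices of the [l] points that follow [x0] on its cycle, and each
    choice contributes [V l]. *)
Lemma sum_Sym_by_cycle (R : nmodType) n (S : {set 'I_n}) x0 k (G : 'S_n -> R)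
    (V : nat -> R) : x0 \in S -> #|S| = k.+1 ->
  (forall l (t : l.-tuple 'I_n) (tS : all (mem (S :\ x0)) t) (t_uniq : uniq t),
     \sum_(s' in Sym (cycle_compl S x0 t)) G (cycle_perm tS t_uniq * s')%g = V l) ->
  \sum_(s in Sym S) G s = \sum_(l < k.+1) V l *+ k ^_ l.
Proof.
move=> Sx0 cardS GV.
have porbS s : s \in Sym S -> porbit s x0 \subset S.
  rewrite inE => sS; apply/fintype.subsetP => y /porbitP[r ->]; rewrite permX.
  by elim: r => //= r IHr; rewrite (perm_closed _ sS).
have porb_le s : s \in Sym S -> (#|porbit s x0|.-1 < k.+1)%N.
  by move=> sS; rewrite prednK ?card_porbit_gt0 // -cardS subset_leq_card ?porbS.
rewrite (partition_big (fun s => inord #|porbit s x0|.-1 : 'I_k.+1) predT) //=.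
apply: eq_bigr => l _.
rewrite (eq_bigl (fun s => (s \in Sym S) && (#|porbit s x0| == l.+1))) => [|s]; last first.
  case: (boolP (s \in Sym S)) => //= sS; rewrite -(inj_eq val_inj) /= inordK ?porb_le //.
  by rewrite -eqSS prednK ?card_porbit_gt0.
pose tail (s : 'S_n) : l.-tuple 'I_n := Tuple (introT eqP (size_traject s (s x0) l)).
rewrite (partition_big tail (fun t => all (mem (S :\ x0)) t && uniq t)) /=; last first.
  move=> s /andP[sS /eqP xl]; have := uniq_traject_porbit s x0.
  rewrite xl trajectS /= => /andP[x0t ->]; rewrite andbT; apply/allP => y yt.
  rewrite -[mem _ _]/(y \in S :\ x0) !inE; apply/andP; split.
    by apply: contraNneq x0t => yx; rewrite -{1}yx.
  apply: (fintype.subsetP (porbS s sS)); rewrite porbit_traject xl trajectS.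
  by rewrite inE yt orbT.
rewrite (eq_bigr (fun=> V l)) => [|t /andP[tS t_uniq]]; last first.
  rewrite -(GV l t tS t_uniq) (reindex_inj (mulgI (cycle_perm tS t_uniq))) /=.
  apply: eq_bigl => s'; rewrite -andbA -(glue_cond Sx0 tS t_uniq).
  by rewrite -(inj_eq val_inj).
rewrite sumr_const; congr (_ *+ _).
transitivity (#|mem (S :\ x0)| ^_ l).
  by rewrite -card_uniq_tuples; apply: eq_card => t; rewrite !inE.
by have := cardsD1 x0 S; rewrite Sx0 cardS add1n => -[<-].
Qed.

Lemma eq_mark_color n q (s : 'S_n) (c c' : {ffun 'I_n -> 'I_q.+1}) x :
  (forall r, c (iter r s x) = c' (iter r s x)) -> mark s c x = mark s c' x.
Proof.
move=> cc'; rewrite !(mark_word _ (esym (prednK (card_porbit_gt0 s x)))).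
by congr word_mark; apply/ffunP => t; rewrite !ffunE cc'.
Qed.

(** * The law of the marks of a random coloured permutation *)

Section MarkLaw.
Variables (R : numFieldType) (n q : nat) (p : 'I_q.+1 -> R).
Hypothesis p_sum1 : \sum_a p a = 1.

Definition word_mark_prob l i : R :=
  \sum_(a : {ffun 'I_l.+1 -> 'I_q.+1}) weight p a * (word_mark a == i)%:R.

(** [m i] stands for a number of cycles of the shuffle, while marks are counted point by point;
    hence the factor [i.+1]. *)
Definition marks_are N (m : 'I_N -> nat) (S : {set 'I_n}) s c : bool :=
  [forall i : 'I_N, @mark_count n q S s c i.+1 == (i.+1 * m i)%N].

(** A cycle of length [l.+1] and mark [i.+1] has as many points as [l.+1 %/ i.+1] cycles of length
    [i.+1]. *)
Definition remove_mark N (m : 'I_N -> nat) (i : 'I_N) l : 'I_N -> nat :=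
  fun i' => (m i' - (i' == i) * (l.+1 %/ i.+1))%N.

Section Glue.
Variables (S : {set 'I_n}) (x0 : 'I_n) (l : nat) (t : l.-tuple 'I_n).
Hypotheses (Sx0 : x0 \in S) (tS : all (mem (S :\ x0)) t) (t_uniq : uniq t).
Variables (s' : 'S_n).
Hypothesis s'_on : s' \in Sym (cycle_compl S x0 t).
Let s : 'S_n := (cycle_perm tS t_uniq * s')%g.
Variables (N : nat) (m : 'I_N -> nat).
Hypothesis S_le : (#|S| <= N)%N.

(** Only the term of the mark of [x0] can be nonzero; the conditions of divisibility and size guard
    the truncated operations in [remove_mark]. *)
Lemma glue_marks_are c :
  (marks_are m S s c)%:R = \sum_(i < N)
    (if ((i.+1 %| l.+1) && (l.+1 %/ i.+1 <= m i))%N then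
      (mark s c x0 == i.+1)%:R *
      (marks_are (remove_mark m i l) (cycle_compl S x0 t) s' c)%:R else 0 : R).
Proof.
have orb := glue_porbit tS t_uniq s'_on; rewrite -/s in orb.
have mark_dvd : (mark s c x0 %| l.+1)%N by rewrite (mark_word c orb) word_mark_dvd.
have l_le : (l.+1 <= #|S|)%N.
  have <- : size (x0 :: t) = l.+1 by rewrite /= size_tuple.
  rewrite -(card_uniqP (cycle_uniq tS t_uniq)).
  by apply/subset_leq_card/fintype.subsetP => y /(cycle_sub Sx0 tS).
have mark_lt : ((mark s c x0).-1 < N)%N.
  rewrite prednK ?mark_gt0 // (leq_trans (dvdn_leq _ mark_dvd)) //.
  exact: leq_trans l_le S_le.
have [i0 i0E] : exists i0 : 'I_N, mark s c x0 = i0.+1.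
  by exists (Ordinal mark_lt); rewrite /= prednK ?mark_gt0.
rewrite (bigD1 i0) //= big1 ?addr0 => [|i ii0]; last first.
  by rewrite i0E eqSS (inj_eq val_inj) eq_sym (negbTE ii0) mul0r if_same.
rewrite i0E eqxx mul1r -i0E mark_dvd /=.
have lE : (l.+1 = i0.+1 * (l.+1 %/ i0.+1))%N by rewrite -i0E mulnC divnK.
have cnt i := glue_mark_count Sx0 tS t_uniq s'_on c i; rewrite -/s in cnt.
set j := (l.+1 %/ _)%N; have jE : j = (l.+1 %/ i0.+1)%N by rewrite /j i0E.
have -> : marks_are m S s c = (j <= m i0)%N &&
    marks_are (remove_mark m i0 l) (cycle_compl S x0 t) s' c.
  apply/forallP/andP => [mS|[j_le /forallP mC] i].
    have j_le : (j <= m i0)%N.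
      have := mS i0; rewrite cnt i0E eqxx mul1n {1}lE => /eqP e.
      by rewrite jE -(leq_pmul2l (ltn0Sn i0)) -e leq_addr.
    split=> //; apply/forallP => i; have := mS i; rewrite cnt i0E eqSS (inj_eq val_inj).
    rewrite /remove_mark (eq_sym i).
    case: (i0 =P i) => [<-|_]; last by rewrite !mul0n subn0 add0n.
    rewrite !mul1n mulnBr {1}lE => /eqP <-.
    by rewrite addKn.
  have := mC i; rewrite cnt i0E eqSS (inj_eq val_inj).
  rewrite /remove_mark (eq_sym i).
  case: (i0 =P i) => [<-|_]; last by rewrite !mul0n subn0 add0n.
  rewrite !mul1n mulnBr => /eqP ->; rewrite {1}lE subnKC //.
  by rewrite leq_pmul2l // -jE.
by case: ifP.
Qed.

(** The mark of [x0] reads the colours on its cycle and the remaining marks read those off it, so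
    the two are independent. *)
Lemma glue_weight i (m' : 'I_N -> nat) :
  \sum_c weight p c * ((mark s c x0 == i)%:R *
    (marks_are m' (cycle_compl S x0 t) s' c)%:R) =
  word_mark_prob l i *
  \sum_c weight p c * (marks_are m' (cycle_compl S x0 t) s' c)%:R.
Proof.
have orb := glue_porbit tS t_uniq s'_on; rewrite -/s in orb.
have [tr _] := glue_traject tS t_uniq s'_on; rewrite -/s in tr.
have iter_y r : iter r s x0 \in x0 :: t.
  by rewrite -tr -orb -porbit_traject -permX mem_porbit.
rewrite (weight_indep p_sum1 (D := mem (x0 :: t))) => [|c c' cc'|c c' cc'].
- congr (_ * _); rewrite /word_mark_prob.
  rewrite -(weight_marginal p_sum1 (y := fun r : 'I_l.+1 => iter r s x0)
    (fun a => (word_mark a == i)%:R)).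
    by apply: eq_bigr => c _; rewrite (mark_word c orb).
  move=> a b ab; apply/val_inj => /=.
  have := uniq_traject_porbit s x0; rewrite orb => /(uniqP x0) u.
  apply: u; rewrite ?inE ?size_traject ?ltn_ord //.
  by rewrite !nth_traject.
- by rewrite (eq_mark_color (c' := c')) // => r; apply: cc'; apply: iter_y.
congr (_%:R); congr nat_of_bool; apply: eq_forallb => i'; congr (_ == _).
apply: eq_card => x; rewrite !inE; case: (boolP (x \in cycle_compl S x0 t)); last first.
  by rewrite inE => /negbTE; rewrite !inE => ->.
move=> xC; rewrite (eq_mark_color (c' := c')) // => r; apply: cc'.
have : iter r s' x \in cycle_compl S x0 t.
  have := s'_on; rewrite inE => s'_p.
  by elim: r => //= r IHr; rewrite (perm_closed _ s'_p).
by rewrite cycle_compl_mem => /andP[].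
Qed.

End Glue.

Variable b : nat -> nat -> R.
Hypothesis b0 : forall i, b i 0 = 1.
(** For the series [B] with coefficients [b i k], this says that [x d/dx log B(x^i)] has coefficient
    [word_mark_prob l i] at [x^(l+1)]. Any [K] from [i * k] on is allowed, so that one range of [l]
    serves every [i]. *)
Hypothesis b_rec : forall i k K, (0 < i)%N -> (i * k <= K)%N ->
  (i * k)%:R * b i k = \sum_(l < K)
    (if ((i %| l.+1) && (l.+1 %/ i <= k))%N then
       word_mark_prob l i * b i (k - l.+1 %/ i)%N else 0).

(** Strong induction on the size of [S]: taking out the cycle of [x0] leaves a smaller instance, and
    [k ^_ l * (k - l)! = k!] makes the factorial independent of the length removed. *)
Lemma mark_count_law N (m : 'I_N -> nat) (S : {set 'I_n}) : (#|S| <= N)%N ->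
  \sum_(s in Sym S) \sum_c weight p c * (marks_are m S s c)%:R =
  ((#|S|)`!)%:R * (if (\sum_(i < N) i.+1 * m i == #|S|)%N then \prod_(i < N) b i.+1 (m i) else 0).
Proof.
have [K] := ubnP #|S|; elim: K => // K IHK in S m *; rewrite ltnS => S_leK S_leN.
have [->|[x0 Sx0]] := set_0Vmem S.
  have ev s c : marks_are m (finset.set0) s c = [forall i, m i == 0%N].
    apply: eq_forallb => i; rewrite [mark_count _ _ _ _]eq_card0 => [|x].
      by rewrite eq_sym muln_eq0.
    by rewrite !inE.
  under eq_bigr do under eq_bigr do rewrite ev.
  under eq_bigr do rewrite -big_distrl /= weight_sum1 // mul1r.
  rewrite sumr_const card_Sym -[LHS]mulr_natl; congr (_ * _).
  rewrite cards0; case: ifPn => [|]; rewrite sum_nat_eq0.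
    move=> /forallP m0; rewrite big1 => [|i _]; last first.
      by have := m0 i; rewrite muln_eq0 /= => /eqP ->.
    by have -> : [forall i, m i == 0%N] by apply/forallP => i; have := m0 i; rewrite muln_eq0.
  move=> m0; have -> // : [forall i, m i == 0%N] = false.
  by apply/negbTE; apply: contra m0 => /forallP m0; apply/forallP => i; rewrite muln_eq0 m0.
case cardS: #|S| => [|k]; first by rewrite (cards0_eq cardS) inE in Sx0.
pose B := \prod_(i < N) b i.+1 (m i).
pose tot := (\sum_(i < N) i.+1 * m i)%N.
pose rest (i : 'I_N) := \prod_(i' | i' != i) b i'.+1 (m i').
pose V l : R := ((k - l)`!)%:R * (if tot == k.+1 then \sum_(i < N)
  (if ((i.+1 %| l.+1) && (l.+1 %/ i.+1 <= m i))%N then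
     word_mark_prob l i.+1 * b i.+1 (m i - l.+1 %/ i.+1)%N * rest i else 0) else 0).
rewrite (sum_Sym_by_cycle (V := V) Sx0 cardS) => [|l t tS t_uniq]; last first.
  have cardC : #|cycle_compl S x0 t| = (k - l)%N.
    by rewrite card_cycle_compl // cardS subSS.
  have l_le : (l <= k)%N.
    rewrite -ltnS -cardS; have <- : size (x0 :: t) = l.+1 by rewrite /= size_tuple.
    rewrite -(card_uniqP (cycle_uniq tS t_uniq)).
    by apply/subset_leq_card/fintype.subsetP => y /(cycle_sub Sx0 tS).
  transitivity (\sum_(i < N) if ((i.+1 %| l.+1) && (l.+1 %/ i.+1 <= m i))%N then
      word_mark_prob l i.+1 * (\sum_(s' in Sym (cycle_compl S x0 t)) \sum_c
        weight p c * (marks_are (remove_mark m i l) (cycle_compl S x0 t) s' c)%:R)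
      else 0).
    transitivity (\sum_(i < N) \sum_(s' in Sym (cycle_compl S x0 t))
        (if ((i.+1 %| l.+1) && (l.+1 %/ i.+1 <= m i))%N then \sum_c weight p c *
          ((mark (cycle_perm tS t_uniq * s')%g c x0 == i.+1)%:R *
           (marks_are (remove_mark m i l) (cycle_compl S x0 t) s' c)%:R) else 0)).
      rewrite [RHS]exchange_big /=; apply: eq_bigr => s' s'_on.
      under [LHS]eq_bigr do rewrite (glue_marks_are Sx0 tS t_uniq s'_on) // mulr_sumr.
      rewrite [LHS]exchange_big /=; apply: eq_bigr => i _; case: ifP => // _.
      by rewrite big1 // => c _; rewrite mulr0.
    apply: eq_bigr => i _; case: ifP => _; last by rewrite big1.
    rewrite mulr_sumr; apply: eq_bigr => s' s'_on.
    exact: glue_weight.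
  rewrite /V -[X in _ = _ * X](_ : \sum_(i < N) (if tot == k.+1 then
    if ((i.+1 %| l.+1) && (l.+1 %/ i.+1 <= m i))%N then
     word_mark_prob l i.+1 * b i.+1 (m i - l.+1 %/ i.+1)%N * rest i else 0 else 0) = _);
    last by case: ifP => // _; rewrite big1.
  rewrite mulr_sumr; apply: eq_bigr => i _; case: ifP => [/andP[i_dvd j_le]|_]; last first.
    by rewrite if_same mulr0.
  rewrite IHK ?cardC; [|by rewrite (leq_trans _ S_leK) // cardS ltnS leq_subr
    |by rewrite (leq_trans _ S_leN) // cardS (leq_trans (leq_subr _ _))].
  have -> : (\sum_(i0 < N) i0.+1 * remove_mark m i l i0 == k - l)%N = (tot == k.+1).
    have -> : tot = (\sum_(i0 < N) i0.+1 * remove_mark m i l i0 + l.+1)%N.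
      rewrite /tot (bigD1 i) //= [in RHS](bigD1 i) //= addnAC; congr (_ + _)%N.
        rewrite /remove_mark eqxx mul1n mulnBr [(i.+1 * (_ %/ _))%N]mulnC divnK //.
        by rewrite subnK // -(divnK i_dvd) mulnC leq_pmul2l.
      apply: eq_bigr => i' ii'; rewrite /remove_mark (negbTE ii').
      by rewrite mul0n subn0.
    by rewrite -(eqn_add2r l.+1) [(k - l + _)%N]addnS subnK.
  case: ifP => _; last by rewrite !mulr0.
  rewrite mulrCA; congr (_ * _); rewrite -mulrA; congr (_ * _).
  rewrite (bigD1 i) //= {1}/remove_mark eqxx mul1n; congr (_ * _).
  by apply: eq_bigr => i' ii'; rewrite /remove_mark (negbTE ii') mul0n subn0.
transitivity (\sum_(l < k.+1) (k`!)%:R * (if tot == k.+1 then \sum_(i < N)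
  (if ((i.+1 %| l.+1) && (l.+1 %/ i.+1 <= m i))%N then
     word_mark_prob l i.+1 * b i.+1 (m i - l.+1 %/ i.+1)%N * rest i else 0) else 0)).
  apply: eq_bigr => l _; rewrite /V -[LHS]mulr_natl mulrA -natrM ffact_fact //.
  by rewrite -ltnS.
rewrite -mulr_sumr factS mulnC natrM -mulrA; congr (_ * _).
rewrite -/tot; case: eqP => [totE|_]; last by rewrite big1 ?mulr0.
(* The factor missing from [k.+1!] is the number of points, split by mark; each summand feeds the
   recursion of its own [b i.+1]. *)
have -> : k.+1%:R = \sum_(i < N) (i.+1 * m i)%:R :> R by rewrite -natr_sum -totE.
rewrite exchange_big /= mulr_suml; apply: eq_bigr => i _.
rewrite /B (bigD1 i) //= mulrA -/(rest i).
rewrite (b_rec (K := k.+1)) //; last by rewrite -totE /tot (bigD1 i) //= leq_addr.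
by rewrite mulr_suml; apply: eq_bigr => l _; case: ifP; rewrite ?mul0r.
Qed.

End MarkLaw.

(** * Necklaces *)

Lemma card_porbit_level (T : finType) (s : {perm T}) (D : {set T}) i :
  {in D, forall x, porbit s x \subset D} ->
  {in D, forall x, #|porbit s x| = i} ->
  #|D| = (#|[set porbit s x | x in D]| * i)%N.
Proof.
move=> Dcl Di; rewrite -sum1_card (partition_big_imset (porbit s)) /=.
rewrite -sum_nat_const; apply: eq_bigr => _ /imsetP[x xD ->].
rewrite -(Di x xD) -sum1_card; apply: eq_bigl => y.
rewrite eq_porbit_mem; case: (boolP (y \in porbit s x)); rewrite ?andbT ?andbF //.
by move=> /(fintype.subsetP (Dcl x xD)).
Qed.

Lemma level_card_porbit n (s : 'S_n) i :
  level_card (fun x => #|porbit s x|) i = (ncycles i s * i)%N.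
Proof.
pose D := [set x | #|porbit s x| == i].
have -> : level_card (fun x => #|porbit s x|) i = #|D| by rewrite cardsE.
rewrite (@card_porbit_level _ s D i) => [|x|x]; rewrite ?inE.
- congr (_ * _)%N; apply: eq_card => C; rewrite !inE; apply/imsetP/andP.
    by move=> [x]; rewrite inE => /eqP xi ->; rewrite xi imset_f.
  by move=> [/imsetP[x _ ->] xi]; exists x; rewrite ?inE.
- move=> xi; apply/fintype.subsetP => y yx; rewrite inE.
  by have /eqP -> : porbit s y == porbit s x by rewrite eq_porbit_mem.
by move/eqP.
Qed.

(** * Möbius inversion over divisors *)

Section Moebius.

Lemma big_divisors (V : nmodType) (F : nat -> V) n K : (0 < n < K)%N ->
  \sum_(d <- divisors n) F d = \sum_(d < K | (d %| n)%N) F d.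
Proof.
move=> /andP[n_gt0 n_lt]; rewrite -(big_mkord (fun d => d %| n)%N) -big_filter.
apply: perm_big; apply: uniq_perm; rewrite ?filter_uniq ?iota_uniq ?divisors_uniq //.
move=> d; rewrite mem_filter -dvdn_divisors // mem_index_iota /=.
by case: (boolP (d %| n)%N) => //= /(dvdn_leq n_gt0)/leq_ltn_trans ->.
Qed.

Lemma moebius_prime_mul p e : prime p -> (0 < e)%N ->
  moebius (p * e) = if (p %| e)%N then 0 else - moebius e.
Proof.
move=> p_pr e_gt0; have p_gt0 := prime_gt0 p_pr.
have logpe r : logn r (p * e) = ((r == p) + logn r e)%N.
  by rewrite lognM // logn_prime.
case: ifPn => pe.
  rewrite /moebius ifN //; apply/allPn; exists p.
    by rewrite primesM // primes_prime // inE eqxx.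
  by rewrite logpe eqxx eqSS -lt0n logn_gt0 mem_primes p_pr e_gt0.
have pe' : p \notin primes e by rewrite mem_primes p_pr e_gt0.
have perm_pe : perm_eq (primes (p * e)) (p :: primes e).
  apply: uniq_perm; rewrite ?primes_uniq //= ?pe' ?primes_uniq // => r.
  by rewrite primesM // primes_prime // !inE.
have p0 : logn p e = 0%N by apply/eqP; rewrite -leqn0 leqNgt logn_gt0.
rewrite /moebius (perm_all _ perm_pe) (perm_size perm_pe) /= logpe eqxx p0 /=.
rewrite (eq_in_all (a2 := fun r => logn r e == 1%N)) => [|r re].
  by case: ifP => _; rewrite ?oppr0 // exprS mulN1r.
rewrite logpe; case: (r =P p) => [rp|_]; last by [].
by rewrite -rp re in pe'.
Qed.

(** With [n = p * m], the divisors [p * e] contribute minus the sum of [moebius e] over the [e]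
    dividing [m] and prime to [p]; the divisors of [n] prime to [p] are these same [e]. *)
Lemma sum_moebius n : (0 < n)%N -> \sum_(d <- divisors n) moebius d = (n == 1)%N%:R.
Proof.
move=> n_gt0; have [n_le1|n_gt1] := leqP n 1.
  have -> : n = 1%N by apply/eqP; rewrite eqn_leq n_le1.
  by rewrite (_ : divisors 1 = [:: 1%N]) // big_seq1.
rewrite gtn_eqF //; pose p := pdiv n; have p_pr : prime p := pdiv_prime n_gt1.
have p_gt0 := prime_gt0 p_pr.
set m := (n %/ p)%N; have nE : n = (p * m)%N by rewrite mulnC divnK // pdiv_dvd.
have m_gt0 : (0 < m)%N by move: n_gt0; rewrite nE muln_gt0 => /andP[].
rewrite (bigID (fun d => p %| d)%N) /= -big_filter.
rewrite (perm_big (map (muln p) (divisors m))) /=; last first.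
  apply: uniq_perm.
  - by rewrite filter_uniq ?divisors_uniq.
  - rewrite map_inj_uniq ?divisors_uniq // => a b /eqP.
    by rewrite eqn_pmul2l // => /eqP.
  move=> d; rewrite mem_filter -dvdn_divisors //; apply/andP/mapP => [[pd dn]|[e]].
    exists (d %/ p)%N; last by rewrite mulnC divnK.
    by rewrite -dvdn_divisors // -(@dvdn_pmul2l p) // -nE mulnC divnK.
  by rewrite -dvdn_divisors // => em ->; rewrite dvdn_mulr // nE dvdn_pmul2l.
rewrite big_map; pose f d := if (p %| d)%N then 0 else moebius d.
have -> : \sum_(e <- divisors m) moebius (p * e) = - \sum_(e <- divisors m) f e.
  rewrite -sumrN big_seq [in RHS]big_seq; apply: eq_bigr => e.
  rewrite -dvdn_divisors // => em; rewrite moebius_prime_mul ?(dvdn_gt0 m_gt0) //.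
  by rewrite /f; case: ifP; rewrite ?oppr0.
have -> : \sum_(d <- divisors n | ~~ (p %| d)%N) moebius d = \sum_(d <- divisors n) f d.
  by rewrite big_mkcond; apply: eq_bigr => d _; rewrite /f; case: (p %| d)%N.
rewrite !(@big_divisors _ _ _ n.+1) ?n_gt0 ?m_gt0 ?ltnS //= ?leq_div //.
rewrite addrC; apply/eqP; rewrite subr_eq0; apply/eqP.
rewrite big_mkcond [RHS]big_mkcond; apply: eq_bigr => d _; rewrite /f.
case: (boolP (p %| d)%N) => pd; first by rewrite !if_same.
have co : coprime d p by rewrite coprime_sym prime_coprime.
by rewrite -(Gauss_dvdr m co) -nE.
Qed.

Lemma moebius_inversion (R : pzRingType) (g h : nat -> R) n :
  (forall m, (0 < m)%N -> h m = \sum_(d <- divisors m) g d) -> (0 < n)%N ->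
  g n = \sum_(d <- divisors n) (moebius d)%:~R * h (n %/ d)%N.
Proof.
move=> hg n_gt0; rewrite (@big_divisors _ _ _ n.+1) ?n_gt0 ?leqnn //.
transitivity (\sum_(d < n.+1) \sum_(e < n.+1)
    (if (d * e %| n)%N then (moebius d)%:~R * g e else 0)); last first.
  rewrite [RHS]big_mkcond; apply: eq_bigr => d _; case: (boolP (d %| n)%N) => dn; last first.
    rewrite big1 // => e _; case: ifP => // den; case/negP: dn.
    exact: dvdn_trans (dvdn_mulr _ (dvdnn d)) den.
  have d_gt0 := dvdn_gt0 n_gt0 dn.
  have nd_gt0 : (0 < n %/ d)%N by rewrite divn_gt0 // dvdn_leq.
  rewrite hg // (@big_divisors _ _ _ n.+1) ?nd_gt0 ?ltnS ?leq_div // mulr_sumr.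
  rewrite -big_mkcond; apply: eq_bigl => e.
  by rewrite dvdn_divRL // mulnC.
rewrite exchange_big /= (bigD1 (Ordinal (ltnSn n))) //= [X in _ + X]big1 => [|e en].
  have n1 : (1 < n.+1)%N by [].
  rewrite addr0 -big_mkcond (big_pred1 (Ordinal n1)) => [|d] /=; last first.
    by rewrite -[X in (_ %| X)%N]mul1n dvdn_pmul2r // dvdn1 -(inj_eq val_inj).
  by rewrite [moebius _](_ : _ = 1) ?mul1r.
have [e_dvd|e_ndvd] := boolP (e %| n)%N; last first.
  rewrite big1 // => d _; case: ifP => // den; case/negP: e_ndvd.
  exact: dvdn_trans (dvdn_mull _ (dvdnn e)) den.
have e_gt0 := dvdn_gt0 n_gt0 e_dvd.
have ne_gt0 : (0 < n %/ e)%N by rewrite divn_gt0 // dvdn_leq.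
transitivity ((\sum_(d <- divisors (n %/ e)) moebius d)%:~R * g e).
  rewrite (@big_divisors _ _ _ n.+1) ?ne_gt0 ?ltnS ?leq_div // -big_mkcond.
  rewrite rmorph_sum /= mulr_suml; apply: eq_bigl => d.
  by rewrite dvdn_divRL.
rewrite sum_moebius // (_ : (n %/ e == 1)%N = false) ?mul0r //.
apply/negbTE; apply: contra en => /eqP ne1; rewrite -(inj_eq val_inj) /=.
by apply/eqP; have := divnK e_dvd; rewrite ne1 mul1n.
Qed.

End Moebius.

Section Necklaces.
Variable q : nat.
Local Notation word l := {ffun 'I_l.+1 -> 'I_q.+1}.

Definition nonzero l (a : word l) := ~~ [exists t, a t == ord0].

Definition word_period l (a : word l) := min_period (fun r => a (inZp r)).

Definition period_count l i := #|[set a : word l | nonzero a && (word_period a == i)]|.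

Definition primitive_count i := period_count i.-1 i.

Lemma word_is_period l (a : word l) : is_period (fun r => a (inZp r)) l.+1.
Proof. by move=> t; congr (a _); apply/val_inj; rewrite /= modnDr. Qed.

Lemma nonzeroP l (a : word l) : reflect (forall t, a t != ord0) (nonzero a).
Proof. by rewrite /nonzero negb_exists; apply: forallP. Qed.

(** A word of length [l.+1] and minimal period [i] is a repetition of its first [i] letters. *)
Lemma period_countE l i : (0 < i)%N -> (i %| l.+1)%N -> period_count l i = primitive_count i.
Proof.
case: i => // i _ il; rewrite /primitive_count /=.
pose ext (a : word i) : word l := [ffun t : 'I_l.+1 => a (inZp t)].
pose res (a : word l) : word i := [ffun t : 'I_i.+1 => a (inZp t)].
have extE a r : ext a (inZp r) = a (inZp r).
  by rewrite ffunE; congr (a _); apply/val_inj; rewrite /= modn_dvdm.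
have resE a r : word_period a = i.+1 -> res a (inZp r) = a (inZp r).
  move=> ai; have [_ per _] := min_periodP (ltn0Sn l) (word_is_period a).
  rewrite -/(word_period a) ai in per.
  by rewrite ffunE /= -(is_periodM (r %/ i.+1) per) addnC -divn_eq.
rewrite /period_count -!sum1_card (reindex_onto ext res) => [|a]; last first.
  rewrite inE => /andP[_ /eqP ai]; apply/ffunP => t; rewrite -[t]valZpK extE.
  exact: resE.
apply: eq_bigl => a; rewrite !inE.
have -> : word_period (ext a) = word_period a.
  by congr min_period; apply/funext => r; apply: extE.
have -> : nonzero (ext a) = nonzero a.
  apply/nonzeroP/nonzeroP => a_nz t; last by rewrite ffunE.
  by rewrite -[t]valZpK -extE.
have -> : res (ext a) == a; last by rewrite andbT.
by apply/eqP/ffunP => t; rewrite ffunE extE valZpK.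
Qed.

Lemma card_nonzero l : #|[set a : word l | nonzero a]| = (q ^ l.+1)%N.
Proof.
transitivity (#|predC1 (ord0 : 'I_q.+1)| ^ #|'I_l.+1|)%N; last first.
  by rewrite cardC1 !card_ord.
rewrite -card_ffun_on; apply: eq_card => a; rewrite inE.
by apply/nonzeroP/ffun_onP => a_nz t; have := a_nz t; rewrite ?inE.
Qed.

Lemma sum_primitive_count n : (0 < n)%N ->
  (\sum_(d <- divisors n) primitive_count d = q ^ n)%N.
Proof.
case: n => // l _; rewrite -card_nonzero -sum1_card.
transitivity (\sum_(a in [set a : word l | nonzero a])
    \sum_(d <- divisors l.+1) (word_period a == d : nat))%N; last first.
  apply: eq_bigr => a _; have [d_gt0 _ d_min] := min_periodP (ltn0Sn l) (word_is_period a).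
  rewrite (bigD1_seq (word_period a)) ?divisors_uniq //=; last first.
    by rewrite -dvdn_divisors //; apply/d_min/word_is_period.
  by rewrite eqxx big1 // => d; rewrite eq_sym => /negbTE ->.
rewrite exchange_big big_seq [RHS]big_seq; apply: eq_bigr => d.
rewrite -dvdn_divisors // => d_dvd.
rewrite -(period_countE (dvdn_gt0 (ltn0Sn l) d_dvd) d_dvd) /period_count -sum1_card.
rewrite [RHS](eq_bigr (fun a => if word_period a == d then 1 else 0)%N) => [|a _].
  2: by case: eqP.
by rewrite -big_mkcondr; apply: eq_bigl => a; rewrite !inE.
Qed.

(** Rotation permutes the primitive words of length [i], with all orbits of size [i]. *)
Lemma primitive_count_dvd i : (0 < i)%N -> (i %| primitive_count i)%N.
Proof.
case: i => // i _; rewrite /primitive_count /period_count /=.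
pose rot_fun (a : word i) : word i := [ffun t : 'I_i.+1 => a (inZp t.+1)].
have rotE a r : rot_fun a (inZp r) = a (inZp r.+1).
  by rewrite ffunE; congr (a _); apply/val_inj; rewrite /= -addn1 modnDml addn1.
have rot_inj : injective rot_fun.
  move=> a b ab; apply/ffunP => t; rewrite -[t]valZpK.
  have shift (c : word i) r : c (inZp r) = rot_fun c (inZp (r + i)).
    by rewrite rotE; congr (c _); apply/val_inj; rewrite /= -addnS modnDr.
  by rewrite (shift a) (shift b) ab.
pose s := perm rot_inj.
have iter_s a r t : iter r s a (inZp t) = a (inZp (t + r)).
  elim: r a t => [|r IHr] a t; first by rewrite addn0.
  by rewrite iterSr IHr permE rotE addnS.
set D := [set a | _].
rewrite (@card_porbit_level _ s D i.+1) ?dvdn_mull // => a; rewrite inE => /andP[a_nz /eqP ai].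
  apply/fintype.subsetP => _ /porbitP[r ->]; rewrite permX inE; apply/andP; split.
    by apply/nonzeroP => t; rewrite -[t]valZpK iter_s; apply/nonzeroP.
  rewrite -[X in _ == X]ai; apply/eqP/eq_min_period => p.
  split=> per t; last by rewrite !iter_s addnAC per.
  have /is_periodM per_l := word_is_period a.
  (* Adding [r * i] undoes the rotation by [r], since [r * i + r] is a multiple of the length
     [i.+1]. *)
  have := per (t + r * i)%N; rewrite !iter_s.
  have -> : (t + r * i + p + r = t + p + r * i.+1)%N.
    by rewrite mulnS [(r + _)%N]addnC !addnA -!addnA; congr (_ + _)%N; rewrite addnCA.
  by rewrite per_l -addnA -mulnSr per_l.
have [_ _ d_min] := min_periodP (ltn0Sn i) (word_is_period a).
apply/eqP; rewrite eqn_leq; apply/andP; split.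
  apply: iter_fix_porbit => //; apply/ffunP => t; rewrite -[t]valZpK iter_s.
  exact: word_is_period.
apply: dvdn_leq; first exact: card_porbit_gt0.
rewrite -{1}ai; apply: d_min => t.
by rewrite -(iter_s a) iter_porbit.
Qed.

Definition necklaces i := (primitive_count i %/ i)%N.

Lemma necklacesE (R : numFieldType) i : (0 < i)%N ->
  (necklaces i)%:R = i%:R^-1 *
    \sum_(d <- divisors i) (moebius d)%:~R * q%:R ^+ (i %/ d) :> R.
Proof.
move=> i_gt0; have i_neq0 : i%:R != 0 :> R by rewrite pnatr_eq0 -lt0n.
apply: (mulfI i_neq0); rewrite mulrA mulfV // mul1r -natrM mulnC divnK; last first.
  exact: primitive_count_dvd.
under eq_bigr do rewrite -natrX.
apply: (@moebius_inversion R (fun d => (primitive_count d)%:R) (fun m => (q ^ m)%:R)) => // m m_gt0.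
by rewrite -natr_sum sum_primitive_count.
Qed.

End Necklaces.

Section UniformLetters.
Variables (R : numFieldType) (q : nat) (gamma : R).

Definition letter_prob (a : 'I_q.+1) : R :=
  if a == ord0 then gamma else (1 - gamma) / q%:R.

Hypothesis q_gt0 : (0 < q)%N.

Lemma letter_prob_nonzero : \sum_(a | a != ord0) letter_prob a = 1 - gamma.
Proof.
rewrite (eq_bigr (fun=> (1 - gamma) / q%:R)) => [|a]; last first.
  by rewrite /letter_prob => /negbTE ->.
rewrite sumr_const (_ : #|_| = q); last by rewrite cardC1 card_ord.
by rewrite -[LHS]mulr_natr divfK // pnatr_eq0 -lt0n.
Qed.

Lemma letter_prob_sum1 : \sum_a letter_prob a = 1.
Proof.
by rewrite (bigD1 ord0) //= letter_prob_nonzero /letter_prob eqxx addrC subrK.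
Qed.

(** A word meeting a zero has its length as mark, which gives the first term; the
    [i * necklaces q i] zero-free words of minimal period [i] are equally likely and give the
    second. *)
Lemma word_mark_probE l i : (0 < i)%N -> word_mark_prob letter_prob l i =
  (l.+1 == i)%:R * (1 - (1 - gamma) ^+ l.+1) +
  (if (i %| l.+1)%N then ((1 - gamma) / q%:R) ^+ l.+1 * (i * necklaces q i)%:R else 0).
Proof.
move=> i_gt0; rewrite /word_mark_prob (bigID (@nonzero q l)) /= addrC; congr (_ + _).
  have nzE : \sum_(a | @nonzero q l a) weight letter_prob a = (1 - gamma) ^+ l.+1.
    rewrite -letter_prob_nonzero -[X in _ ^+ X](card_ord l.+1) -prodr_const.
    rewrite bigA_distr_big; apply: eq_bigl => a.
    by apply/nonzeroP/ffun_onP => a_nz t; have := a_nz t; rewrite ?inE.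
  have -> : 1 - (1 - gamma) ^+ l.+1 = \sum_(a | ~~ @nonzero q l a) weight letter_prob a.
    rewrite -nzE -(weight_sum1 letter_prob_sum1 'I_l.+1) (bigID (@nonzero q l)) /=.
    by rewrite addrAC subrr add0r.
  rewrite mulr_sumr; apply: eq_bigr => a.
  by rewrite negbK /word_mark mulrC => ->.
rewrite (eq_bigr (fun a => ((1 - gamma) / q%:R) ^+ l.+1 * (word_period a == i)%:R)); last first.
  move=> a a_nz; rewrite /word_mark (negbTE a_nz); congr (_ * _).
  rewrite /weight (eq_bigr (fun=> (1 - gamma) / q%:R)) ?prodr_const ?card_ord // => t _.
  by have /nonzeroP/(_ t)/negbTE := a_nz; rewrite /letter_prob => ->.
rewrite -mulr_sumr -natr_sum (_ : \sum_(a | _) _ = period_count q l i)%N; last first.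
  rewrite /period_count -sum1_card big_mkcond [RHS]big_mkcond; apply: eq_bigr => a _.
  by rewrite inE; case: (nonzero a) => //=; case: eqP.
case: ifPn => [il|i_ndvd]; first by rewrite period_countE // mulnC divnK // primitive_count_dvd.
rewrite (_ : period_count q l i = 0)%N ?mulr0 //; apply: eq_card0 => a; rewrite !inE.
have [_ _ d_min] := min_periodP (ltn0Sn l) (word_is_period a).
apply/negbTE; rewrite negb_and; apply/orP; right; apply: contra i_ndvd => /eqP <-.
exact/d_min/word_is_period.
Qed.

End UniformLetters.

(** * The law of the cycle counts *)

Section Convolution.
Variable R : realType.
Implicit Types f g h : nat -> R.

(** Truncation to polynomials, from which convolution inherits commutativity and associativity. *)
Lemma convolution_coef f g N n : (n < N)%N ->
  convolution f g n = ((\poly_(i < N) f i) * (\poly_(i < N) g i))`_n.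
Proof.
move=> n_lt; rewrite coefM; apply: eq_bigr => k _; rewrite !coef_poly.
have k_le : (k <= n)%N by rewrite -ltnS.
by rewrite (leq_ltn_trans k_le n_lt) (leq_ltn_trans (leq_subr k n) n_lt).
Qed.

Lemma convolutionC f g n : convolution f g n = convolution g f n.
Proof. by rewrite !(@convolution_coef _ _ n.+1) // mulrC. Qed.

Lemma eq_convolution f f' g g' n : (forall k, (k <= n)%N -> f k = f' k) ->
  (forall k, (k <= n)%N -> g k = g' k) -> convolution f g n = convolution f' g' n.
Proof.
by move=> ff' gg'; apply: eq_bigr => k _; rewrite ff' ?gg' // ?leq_subr // -ltnS.
Qed.

Lemma convolutionA f g h n :
  convolution f (convolution g h) n = convolution (convolution f g) h n.
Proof.
have -> : convolution (convolution f g) h n =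
    ((\poly_(i < n.+1) f i * \poly_(i < n.+1) g i) * \poly_(i < n.+1) h i)`_n.
  rewrite coefM; apply: eq_bigr => k _.
  by rewrite (@convolution_coef _ _ n.+1) // !coef_poly ltnS leq_subr.
rewrite -mulrA coefM; apply: eq_bigr => k _.
by rewrite (@convolution_coef _ _ n.+1) ?ltnS ?leq_subr // coef_poly ltn_ord.
Qed.

Lemma convolutionDl f f' g n :
  convolution (fun k => f k + f' k) g n = convolution f g n + convolution f' g n.
Proof. by rewrite -big_split; apply: eq_bigr => k _; rewrite mulrDl. Qed.

(** Leibniz rule for [x d/dx], which multiplies the coefficient of [x^n] by [n]. *)
Lemma convolution_euler f g n : n%:R * convolution f g n =
  convolution (fun k => k%:R * f k) g n + convolution f (fun k => k%:R * g k) n.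
Proof.
rewrite mulr_sumr -big_split; apply: eq_bigr => k _ /=.
have -> : n%:R = k%:R + (n - k)%:R :> R by rewrite -natrD subnKC // -ltnS.
by rewrite mulrDl mulrA [in X in _ + X]mulrCA.
Qed.

(* Coefficients of exp (lambda x) / (1 - a x) ^ M. *)
Definition pg_coef (lambda : R) M (a : R) : nat -> R :=
  iter M (convolution (fun k => a ^+ k)) (fun k => lambda ^+ k / (k`!)%:R).

Lemma pg_coef0 lambda M a : pg_coef lambda M a 0 = 1.
Proof.
elim: M => [|M IHM]; first by rewrite /pg_coef /= expr0 divr1.
by rewrite /pg_coef /= /convolution big_ord1 -/(pg_coef _ _ _) subnn IHM expr0 mulr1.
Qed.

(** Applying [x d/dx] to the logarithm of [exp (lambda x) / (1 - a x)^M] gives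
    [lambda x + M (a x + a^2 x^2 + ...)]. *)
Lemma pg_coef_rec lambda M a n : n%:R * pg_coef lambda M a n =
  convolution (fun j => (j == 1)%N%:R * lambda + (0 < j)%N%:R * (M%:R * a ^+ j))
    (pg_coef lambda M a) n.
Proof.
elim: M n => [|M IHM] n.
  case: n => [|n]; first by rewrite mul0r /convolution big_ord1 /= !mul0r addr0 mul0r.
  rewrite /convolution big_ord_recl /= !mul0r addr0 mul0r add0r.
  rewrite big_ord_recl big1 => [|j _]; last by rewrite /= !mul0r mulr0 addr0 mul0r.
  rewrite /= mul0r mulr0 mul1r !addr0 /pg_coef /= subSS subn0 factS natrM exprS.
  have n_neq0 : n.+1%:R != 0 :> R by rewrite pnatr_eq0.
  have f_neq0 : (n`!)%:R != 0 :> R by rewrite pnatr_eq0 -lt0n fact_gt0.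
  move: (n.+1%:R) (n`!%:R) n_neq0 f_neq0 => x y x0 y0.
  by field; rewrite x0 y0.
set B := pg_coef lambda M a; set B' := pg_coef lambda M.+1 a.
have B'E : B' = convolution (fun k => a ^+ k) B by [].
pose ga j := (0 < j)%N%:R * a ^+ j.
have geo k : k%:R * a ^+ k = convolution ga (fun j => a ^+ j) k.
  rewrite /convolution big_ord_recl /= /ga mul0r mul0r add0r.
  rewrite (eq_bigr (fun=> a ^+ k)) => [|j _].
    by rewrite sumr_const card_ord mulr_natl.
  by rewrite -[bump 0 j]/(j.+1) mul1r -exprD subnKC.
rewrite {1}B'E convolution_euler.
rewrite (eq_convolution (f' := convolution ga (fun j => a ^+ j)) (g' := B)) //.
rewrite -convolutionA -B'E.
rewrite [X in _ + X](eq_convolution (f' := fun k => a ^+ k) (g' := convolution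
  (fun j => (j == 1)%N%:R * lambda + (0 < j)%N%:R * (M%:R * a ^+ j)) B)) //.
rewrite convolutionA [X in _ + X](eq_convolution (g' := B) (f' := convolution
  (fun j => (j == 1)%N%:R * lambda + (0 < j)%N%:R * (M%:R * a ^+ j))
  (fun k => a ^+ k))) //; last by move=> k _; apply: convolutionC.
rewrite -convolutionA -B'E -convolutionDl; apply: eq_convolution => // k _.
by rewrite /ga -natr1; ring.
Qed.

Lemma poisson_geometricsE lambda M a n : poisson_geometrics lambda M a n =
  expR (- lambda) * (1 - a) ^+ M * pg_coef lambda M a n.
Proof.
elim: M n => [|M IHM] n.
  by rewrite expr0 mulr1 /pg_coef /poisson_geometrics /= /poisson_mass mulrC.
rewrite /poisson_geometrics /pg_coef !iterS -/(poisson_geometrics _ _ _) -/(pg_coef _ _ _).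
rewrite mulr_sumr; apply: eq_bigr => k _; rewrite IHM /geometric_mass exprS.
by ring.
Qed.

Lemma pg_coef_scale lambda M a c n :
  pg_coef (c * lambda) M (c * a) n = c ^+ n * pg_coef lambda M a n.
Proof.
elim: M n => [|M IHM] n; first by rewrite /pg_coef /= exprMn mulrA.
rewrite /pg_coef !iterS -!/(pg_coef _ _ _) mulr_sumr; apply: eq_bigr => k _.
have -> : c ^+ n = c ^+ k * c ^+ (n - k) by rewrite -exprD subnKC // -ltnS.
by rewrite IHM exprMn; ring.
Qed.

Lemma pg_coef_ge0 lambda M a n : 0 <= lambda -> 0 <= a -> 0 <= pg_coef lambda M a n.
Proof.
move=> l_ge0 a_ge0; elim: M n => [|M IHM] n.
  by rewrite mulr_ge0 ?invr_ge0 ?ler0n ?exprn_ge0.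
by rewrite /pg_coef iterS sumr_ge0 // => k _; rewrite mulr_ge0 ?exprn_ge0 ?IHM.
Qed.

End Convolution.

Section CycleLaw.
Variables (R : realType) (q : nat) (gamma : R).
Hypothesis q_gt0 : (0 < q)%N.

Local Notation p := (@letter_prob R q gamma).

Definition shuffle_mass n (s : 'S_n) : R :=
  \sum_(w | @word_compatible n q w s) weight p w / ((#|zeros w|)`!)%:R.

Definition cycle_prob n (E : (nat -> nat) -> bool) : R :=
  \sum_(s : 'S_n) shuffle_mass s * (E (fun i => ncycles i s))%:R.

Definition cycle_rate i : R := (1 - (1 - gamma) ^+ i) / i%:R.
Definition cycle_param i : R := ((1 - gamma) / q%:R) ^+ i.
Definition cycle_coef i := pg_coef (cycle_rate i) (necklaces q i) (cycle_param i).

Lemma cycle_coef0 i : cycle_coef i 0 = 1.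
Proof. exact: pg_coef0. Qed.

(** This is [pg_coef_rec] multiplied by [i]: only lengths [l.+1 = i * j.+1] contribute, and there
    [word_mark_prob] is [i] times the coefficient of the logarithmic derivative. *)
Lemma cycle_coef_rec i k K : (0 < i)%N -> (i * k <= K)%N ->
  (i * k)%:R * cycle_coef i k = \sum_(l < K)
    (if ((i %| l.+1) && (l.+1 %/ i <= k))%N then
       word_mark_prob p l i * cycle_coef i (k - l.+1 %/ i)%N else 0).
Proof.
move=> i_gt0; case: k => [|k] ik_le.
  rewrite muln0 mul0r big1 // => l _; case: ifP => // /andP[il].
  by rewrite leqNgt divn_gt0 // dvdn_leq.
have K_gt0 : (0 < K)%N by rewrite (leq_trans _ ik_le) // muln_gt0 i_gt0.
case: K K_gt0 ik_le => // K _ ik_le; rewrite -big_mkcond /=.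
rewrite natrM -mulrA pg_coef_rec -/(cycle_coef i) /convolution big_ord_recl /=.
rewrite !mul0r addr0 mul0r add0r mulr_sumr.
have up_lt (j : 'I_k.+1) : ((i * j.+1).-1 < K.+1)%N.
  by rewrite prednK ?muln_gt0 ?i_gt0 // (leq_trans _ ik_le) // leq_mul2l ltn_ord orbT.
rewrite (reindex_onto (fun j => Ordinal (up_lt j)) (fun l => inord (l.+1 %/ i).-1)) /=; last first.
  move=> l /andP[il l_le]; apply/val_inj => /=.
  have d_gt0 : (0 < l.+1 %/ i)%N by rewrite divn_gt0 // dvdn_leq.
  by rewrite inordK ?prednK // mulnC divnK.
have upK (j : 'I_k.+1) : (i * j.+1).-1.+1 = (i * j.+1)%N.
  by rewrite prednK // muln_gt0 i_gt0.
rewrite [RHS](eq_bigl predT) => [|j]; last first.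
  by rewrite upK dvdn_mulr // mulKn //= ltn_ord /= inord_val eqxx.
apply: eq_bigr => j _; rewrite -[bump 0 j]/(j.+1) upK mulKn // mulrA; congr (_ * _).
rewrite word_mark_probE // upK dvdn_mulr // mul1r mulrDr.
have i_neq0 : i%:R != 0 :> R by rewrite pnatr_eq0 -lt0n.
congr (_ + _); last by rewrite natrM /cycle_param -exprM mulrA mulrC.
have -> : ((i * j.+1)%N == i) = (j.+1 == 1)%N by rewrite -{2}[i]muln1 eqn_pmul2l.
case: eqP => [->|_]; last by rewrite !mul0r mulr0.
by rewrite !mul1r muln1 mulrC divfK.
Qed.

Lemma ncycles0 n (s : 'S_n) : ncycles 0 s = 0%N.
Proof.
apply: eq_card0 => C; rewrite !inE; apply/negP => /andP[/imsetP[x _ ->]].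
by rewrite (negbTE (card_porbit_neq0 s x)).
Qed.

Lemma ncycles_le n (s : 'S_n) i : (i * ncycles i s <= n)%N.
Proof.
rewrite mulnC -level_card_porbit -[X in (_ <= X)%N](card_ord n).
exact: max_card.
Qed.

(** After multiplication by [n!], [sum_compatible_words] replaces the shuffle by coloured
    permutations and [mark_count_law], on the set of all cards, evaluates the sum. *)
Lemma cycle_prob_all n N (m : 'I_N -> nat) : (n <= N)%N ->
  cycle_prob n (fun f => [forall i : 'I_N, f i.+1 == m i]) =
  if (\sum_(i < N) i.+1 * m i == n)%N then \prod_(i < N) cycle_coef i.+1 (m i) else 0.
Proof.
move=> n_le; pose F (f : nat -> nat) : R := [forall i : 'I_N, f i.+1 == (i.+1 * m i)%N]%:R.
have nf_neq0 : (n`!)%:R != 0 :> R by rewrite pnatr_eq0 -lt0n fact_gt0.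
apply: (mulfI nf_neq0).
have := mark_count_law (letter_prob_sum1 gamma q_gt0) cycle_coef0 cycle_coef_rec m
  (S := [set: 'I_n]) ; rewrite cardsT card_ord => /(_ n_le) <-.
have Winv (c : {ffun 'I_n -> 'I_q.+1}) (t : 'S_n) :
    weight p [ffun x => c (t x)] = weight p c.
  rewrite /weight [RHS](reindex_inj (@perm_inj _ t)); apply: eq_bigr => x _.
  by rewrite ffunE.
have := sum_compatible_words F Winv => lawE.
transitivity (\sum_(s : 'S_n) \sum_c weight p c * F (level_card (mark s c))); last first.
  rewrite [RHS](eq_bigl predT) => [|s]; last first.
    by rewrite inE; apply/fintype.subsetP => x _; rewrite inE.
  apply: eq_bigr => s _; apply: eq_bigr => c _; congr (_ * _%:R); congr nat_of_bool.
  by apply: eq_forallb => i; congr (_ == _); apply: eq_card => x; rewrite !inE.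
rewrite -lawE mulr_natl (exchange_big_dep predT) //=; congr (_ *+ _).
apply: eq_bigr => s _; rewrite /shuffle_mass mulr_suml; apply: eq_bigr => w _.
congr (_ * _); rewrite /F; congr (_%:R); congr nat_of_bool; apply: eq_forallb => i.
by rewrite level_card_porbit mulnC eqn_pmul2l.
Qed.

(** Events read functions of all lengths, so a finite vector is padded with 0 and its index is
    shifted by one; length 0 has no cycles. *)
Definition extend_counts N K (m : {ffun 'I_N -> 'I_K.+1}) (j : nat) : nat :=
  if j is j'.+1 then if insub j' is Some i then m i else 0 else 0.

Arguments extend_counts : simpl never.

Lemma extend_countsE N K (m : {ffun 'I_N -> 'I_K.+1}) (i : 'I_N) :
  extend_counts m i.+1 = m i.
Proof. by rewrite /extend_counts /= valK. Qed.

Lemma cycle_prob_sum n N K E : (n <= N)%N -> (n <= K)%N ->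
  cycle_prob n E = \sum_(m : {ffun 'I_N -> 'I_K.+1} | E (extend_counts m))
    (if (\sum_(i < N) i.+1 * m i == n)%N then \prod_(i < N) cycle_coef i.+1 (m i) else 0).
Proof.
move=> nN nK; under [RHS]eq_bigr do rewrite -cycle_prob_all //.
rewrite exchange_big /=; apply: eq_bigr => s _.
pose ms : {ffun 'I_N -> 'I_K.+1} := [ffun i : 'I_N => inord (ncycles i.+1 s)].
have msE i : ms i = ncycles i.+1 s :> nat.
  rewrite ffunE inordK // ltnS (leq_trans _ nK) // (leq_trans _ (ncycles_le s i.+1)) //.
  by rewrite leq_pmull.
have extE : extend_counts ms = fun i => ncycles i s.
  apply/funext => -[|j]; first by rewrite ncycles0.
  rewrite /extend_counts; case: insubP => [i _ <-|]; first by rewrite msE.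
  rewrite -leqNgt => N_le; apply/esym/eqP; rewrite -leqn0 leqNgt; apply/negP => c_gt0.
  have := ncycles_le s j.+1; apply/negP; rewrite -ltnNge.
  by apply: leq_ltn_trans nN _; apply: leq_ltn_trans N_le _; rewrite leq_pmulr.
rewrite big_mkcond (bigD1 ms) //= big1 => [|m m_ne]; last first.
  case: ifP => // _; case: forallP => [mE|_]; last by rewrite mulr0.
  case/eqP: m_ne; apply/ffunP => i; apply/val_inj.
  by rewrite /= msE (eqP (mE i)).
rewrite addr0 extE; case: (E _); last by rewrite mulr0.
by congr (_ * _%:R); congr nat_of_bool; apply/esym/forallP => i; rewrite msE.
Qed.

(** In the product formula, lowering the count at [i] from [k] to 0 removes the factor
    [cycle_coef i k] and lowers the deck size by [i * k]. *)
Lemma cycle_prob_shift n i k E : (0 < i)%N ->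
  (forall f g, (forall j, j != i -> f j = g j) -> E f = E g) ->
  cycle_prob n (fun f => (f i == k) && E f) =
  if (i * k <= n)%N then
    cycle_coef i k * cycle_prob (n - i * k) (fun f => (f i == 0%N) && E f)
  else 0.
Proof.
(* [N] is large enough for the length to have a coordinate even when it exceeds [n]. *)
case: i => // i _ E_i; pose N := (n + i.+1)%N.
have nN : (n <= N)%N by rewrite leq_addr.
have iN : (i < N)%N by rewrite /N addnS ltnS leq_addl.
pose i0 := Ordinal iN.
have sumD (m : {ffun 'I_N -> 'I_n.+1}) : (\sum_(j < N) j.+1 * m j =
    i.+1 * m i0 + \sum_(j < N | j != i0) j.+1 * m j)%N by rewrite (bigD1 i0).
rewrite (cycle_prob_sum (N := N) (K := n)) //.
case: ifPn => ik; last first.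
  rewrite big1 // => m; rewrite -[i.+1]/(i0.+1) extend_countsE => /andP[/eqP mk _].
  case: eqP => // m_n; case/negP: ik; rewrite -m_n sumD mk.
  by rewrite -[i.+1]/(i0.+1) leq_addr.
have k_le : (k <= n)%N by apply: leq_trans ik; rewrite leq_pmull.
rewrite (cycle_prob_sum (N := N) (K := n)) ?(leq_trans (leq_subr _ _)) // mulr_sumr.
pose upd (l : 'I_n.+1) (m : {ffun 'I_N -> 'I_n.+1}) : {ffun 'I_N -> 'I_n.+1} :=
  [ffun j => if j == i0 then l else m j].
have updK l l' (m : {ffun 'I_N -> 'I_n.+1}) : m i0 = l' -> upd l' (upd l m) = m.
  move=> ml; apply/ffunP => j; rewrite !ffunE; case: eqP => [->|//].
  by rewrite ml.
rewrite (reindex_onto (upd (inord k)) (upd ord0)) /=; last first.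
  move=> m /andP[+ _]; rewrite -[i.+1]/(i0.+1) extend_countsE => /eqP mk.
  by apply: updK; apply/val_inj; rewrite /= inordK.
have Eupd l m : E (extend_counts (upd l m)) = E (extend_counts m).
  apply: E_i => -[|j] //; rewrite eqSS /extend_counts => ji.
  case: insubP => // j' _ j'E; rewrite ffunE ifN // -(inj_eq val_inj) /=.
  by rewrite j'E.
apply: eq_big => [m|m].
  rewrite -[i.+1]/(i0.+1) !extend_countsE Eupd ffunE eqxx inordK // eqxx /= andbC.
  congr (_ && _); apply/eqP/eqP => [<-|m0]; first by rewrite ffunE eqxx.
  by apply: updK; apply/val_inj.
move=> /andP[_ /eqP um]; have m0 : m i0 = ord0 by rewrite -um ffunE eqxx.
have rest : (\sum_(j < N | j != i0) j.+1 * upd (inord k) m j =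
    \sum_(j < N | j != i0) j.+1 * m j)%N.
  by apply: eq_bigr => j ji; rewrite ffunE (negbTE ji).
rewrite !sumD rest ffunE eqxx inordK // m0 muln0 add0n.
rewrite -[RHS](_ : (if (\sum_(j < N | j != i0) j.+1 * m j == n - i.+1 * k)%N then
  cycle_coef i.+1 k * \prod_(j < N) cycle_coef j.+1 (m j) else 0) = _); last first.
  by case: ifP; rewrite ?mulr0.
have -> : (i.+1 * k + \sum_(j < N | j != i0) j.+1 * m j == n)%N =
    (\sum_(j < N | j != i0) j.+1 * m j == n - i.+1 * k)%N.
  by rewrite -[in RHS](eqn_add2l (i.+1 * k)%N) subnKC.
case: ifP => // _; rewrite (bigD1 i0) //= [in RHS](bigD1 i0) //= m0 cycle_coef0 mul1r.
rewrite ffunE eqxx inordK //; congr (_ * _); apply: eq_bigr => j ji.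
by rewrite ffunE (negbTE ji).
Qed.

Lemma cycle_prob_true n : cycle_prob n (fun=> true) = 1.
Proof.
have nf_neq0 : (n`!)%:R != 0 :> R by rewrite pnatr_eq0 -lt0n fact_gt0.
apply: (mulfI nf_neq0); rewrite mulr1.
have Winv (c : {ffun 'I_n -> 'I_q.+1}) (t : 'S_n) :
    weight p [ffun x => c (t x)] = weight p c.
  rewrite /weight [RHS](reindex_inj (@perm_inj _ t)); apply: eq_bigr => x _.
  by rewrite ffunE.
have := sum_compatible_words (fun=> 1) Winv => lawE.
transitivity (\sum_(s : 'S_n) \sum_(c : {ffun 'I_n -> 'I_q.+1}) weight p c * 1); last first.
  under eq_bigr do under eq_bigr do rewrite mulr1.
  under eq_bigr do rewrite weight_sum1 ?letter_prob_sum1 //.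
  by rewrite sumr_const card_Sn.
rewrite -lawE mulr_natl (exchange_big_dep predT) //=; congr (_ *+ _).
by apply: eq_bigr => s _; rewrite /shuffle_mass mulr_suml; apply: eq_bigr.
Qed.

End CycleLaw.

(** * The limit of the cycle counts *)

Import numFieldNormedType.Exports.
Local Open Scope classical_set_scope.

Section Tannery.
Variable R : realType.
Implicit Types x e : nat -> R.

(** The sum is split at [K]: for smaller [k] the factor [e (n - k)] is small; for larger [k] the
    tail of [x] is small and [e] is bounded by [D]. *)
Lemma convolution_cvg0 x e : cvgn (series (fun k => `|x k|)) ->
  e n @[n --> \oo] --> 0 -> convolution x e n @[n --> \oo] --> 0.
Proof.
move=> x_cvg e_cvg.
have [D D_ub] : has_ubound [set `|e n| | n in setT] by apply: cvg_has_ub; apply/cvg_ex; exists 0.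
have eD n : `|e n| <= D by apply: D_ub; exists n.
have D_ge0 : 0 <= D by apply: le_trans (eD 0%N).
have X_ub : nondecreasing_seq (series (fun k => `|x k|)).
  by apply/nondecreasing_seqP => n; rewrite seriesSr lerDl.
set X := limn (series (fun k => `|x k|)).
have le_X n : series (fun k => `|x k|) n <= X by apply: nondecreasing_cvgn_le.
have X_ge0 : 0 <= X by apply: le_trans (le_X 0%N); rewrite /series /= big_geq.
apply/cvgrPdist_le => eps eps_gt0.
(* Adding 1 keeps the denominators positive when [X] or [D] vanishes. *)
have X1_gt0 : 0 < 2 * (X + 1) by rewrite mulr_gt0 ?ltr0n // ltr_wpDl.
have D1_gt0 : 0 < 2 * (D + 1) by rewrite mulr_gt0 ?ltr0n // ltr_wpDl.
have e1_gt0 : 0 < eps / (2 * (X + 1)) by rewrite divr_gt0.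
have e2_gt0 : 0 < eps / (2 * (D + 1)) by rewrite divr_gt0.
have /cvgrPdist_le/(_ _ e1_gt0)[T _ e_small] := e_cvg.
have /cvgrPdist_le/(_ _ e2_gt0)[K _ x_small] : series (fun k => `|x k|) @ \oo --> X by [].
exists (K + T)%N => // n /= n_ge; rewrite sub0r normrN.
apply: le_trans (ler_norm_sum _ _ _) _.
apply: le_trans (_ : \sum_(k < n.+1) (`|x k| * (eps / (2 * (X + 1))) +
    (if (K <= k)%N then `|x k| else 0) * D) <= _).
  apply: ler_sum => k _; rewrite normrM; case: leqP => kK.
    by apply: ler_wpDl; [rewrite mulr_ge0 // ltW | rewrite ler_wpM2l].
  rewrite mul0r addr0 ler_wpM2l // -normrN -sub0r; apply: e_small => /=.
  rewrite leq_subRL ?(leq_trans (ltnW kK)) ?(leq_trans (leq_addr T K)) //.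
  by rewrite (leq_trans _ n_ge) // leq_add2r ltnW.
rewrite big_split /= -!mulr_suml.
have tail : \sum_(k < n.+1) (if (K <= k)%N then `|x k| else 0) <= eps / (2 * (D + 1)).
  have Kn : (K <= n.+1)%N by rewrite (leq_trans _ (leqnSn _)) // (leq_trans (leq_addr T K)).
  rewrite -(big_mkord predT (fun k => if (K <= k)%N then `|x k| else 0)) /=.
  rewrite (big_cat_nat (leq0n K) Kn) /= big_nat_cond big1 => [|k /andP[/andP[_ kK] _]]; last first.
    by rewrite leqNgt kK.
  rewrite add0r big_nat_cond (eq_bigr (fun k => `|x k|)) => [|k /andP[/andP[-> _] _]//].
  rewrite -big_nat_cond -sub_series_geq //; apply: le_trans (x_small K (leqnn K)).
  by rewrite ger0_norm ?subr_ge0 // lerB.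
have head : \sum_(k < n.+1) `|x k| <= X.
  by rewrite -(big_mkord predT (fun k => `|x k|)); apply: le_X.
rewrite [leRHS](_ : _ = eps / (2 * (X + 1)) * (X + 1) + eps / (2 * (D + 1)) * (D + 1)).
  2: by field; rewrite !gt_eqF // ltr_wpDl.
apply: lerD.
  by rewrite mulrC ler_wpM2l ?(ltW e1_gt0) // (le_trans head) // lerDl.
by apply: ler_pM => //; [apply: sumr_ge0 => k _; case: ifP | rewrite lerDl].
Qed.

Lemma convolution_cvg x e (X l : R) : cvgn (series (fun k => `|x k|)) ->
  series x n @[n --> \oo] --> X -> e n @[n --> \oo] --> l ->
  convolution x e n @[n --> \oo] --> X * l.
Proof.
move=> x_abs x_cvg e_cvg.
have -> : convolution x e = fun n => series x n.+1 * l + convolution x (fun k => e k - l) n.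
  apply/funext => n; rewrite /series /= big_mkord mulr_suml -big_split /=.
  by apply: eq_bigr => k _; rewrite mulrBr addrC subrK.
rewrite -[X * l]addr0; apply: cvgD.
  by apply: cvgM; [rewrite (cvg_shiftS (series x) (nbhs X)) | apply: cvg_cst].
by apply: convolution_cvg0 => //; rewrite -(subrr l); apply: cvgB => //; apply: cvg_cst.
Qed.

End Tannery.

(** * Limits after division by a power series *)

Section Deconvolution.
Variable R : realType.

Lemma exp_coeff_convolution (lambda : R) n :
  convolution (exp_coeff (- lambda)) (exp_coeff lambda) n = (n == 0)%N%:R.
Proof.
have nf k : (k`!)%:R != 0 :> R by rewrite pnatr_eq0 -lt0n fact_gt0.
apply: (mulIf (nf n)).
transitivity ((lambda + - lambda) ^+ n); last first.
  by rewrite subrr expr0n; case: n => [|n]; rewrite ?mul1r ?mul0r.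
rewrite exprDn mulr_suml; apply: eq_bigr => k _; rewrite /exp_coeff /=.
have k_le : (k <= n)%N by rewrite -ltnS.
rewrite -[RHS]mulr_natr -(bin_fact k_le) !natrM.
move: (nf k) (nf (n - k)%N) => nk nnk.
move: (k`!%:R) ((n - k)`!%:R) nk nnk => a b a0 b0.
by field; rewrite a0 b0.
Qed.

(** A factor [1 / (1 - a x)] is undone by the difference [e n.+1 - a * e n], which passes to the
    limit at once; the exponential is undone by convolving with the coefficients of
    [exp (- lambda x)]. *)
Lemma pg_coef_deconvolution (lambda a l : R) M (e g : nat -> R) :
  (forall n, e n = convolution (pg_coef lambda M a) g n) ->
  e n @[n --> \oo] --> l ->
  g n @[n --> \oo] --> expR (- lambda) * (1 - a) ^+ M * l.
Proof.
elim: M e l => [|M IHM] e l eg e_cvg.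
  have -> : g = convolution (exp_coeff (- lambda)) e.
    apply/funext => n; rewrite (eq_convolution (f' := exp_coeff (- lambda))
      (g' := convolution (exp_coeff lambda) g)) //.
    rewrite convolutionA (eq_convolution (f' := fun k => (k == 0)%N%:R) (g' := g)) //.
      rewrite /convolution big_ord_recl /= mul1r subn0 big1 ?addr0 // => k _.
      by rewrite mul0r.
    by move=> k _; rewrite exp_coeff_convolution.
  rewrite expr0 mulr1; apply: convolution_cvg => //.
    have := normed_series_exp_coeff (- lambda); rewrite /normed_series_of => ->.
    exact: is_cvg_series_exp_coeff.
  exact: is_cvg_series_exp_coeff.
pose h := convolution (pg_coef lambda M a) g.
have eh n : e n = convolution (fun k => a ^+ k) h n.
  by rewrite eg /pg_coef iterS -convolutionA.
have hS n : h n.+1 = e n.+1 - a * e n.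
  rewrite !eh {1}/convolution big_ord_recl /= expr0 mul1r subn0.
  rewrite (_ : \sum_(i < n.+1) _ = a * convolution (fun k => a ^+ k) h n) ?addrK //.
  rewrite mulr_sumr; apply: eq_bigr => k _; rewrite -[bump 0 k]/(k.+1) subSS exprS.
  by rewrite mulrA.
have -> : expR (- lambda) * (1 - a) ^+ M.+1 * l =
    expR (- lambda) * (1 - a) ^+ M * (l - a * l) by rewrite exprS; ring.
apply: (IHM h) => //; rewrite -cvg_shiftS.
under eq_fun do rewrite hS.
apply: cvgB; first by rewrite (cvg_shiftS e (nbhs l)).
by apply: cvgM => //; apply: cvg_cst.
Qed.

(** Removing [i]-cycles changes the deck size by multiples of [i], so deconvolution yields a limit
    in each residue class separately. *)
Lemma cvg_residues (g : nat -> R) i (l : R) : (0 < i)%N ->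
  (forall r, (r < i)%N -> g (i * n + r)%N @[n --> \oo] --> l) ->
  g n @[n --> \oo] --> l.
Proof.
move=> i_gt0 g_cvg; apply/cvgrPdist_le => eps eps_gt0.
have : \forall n \near \oo, forall r : 'I_i, `|l - g (i * n + r)%N| <= eps.
  apply: filter_forall => r.
  by have /cvgrPdist_le/(_ _ eps_gt0) := g_cvg r (ltn_ord r).
move=> [N _ gN]; exists (i * N)%N => // n /= n_ge.
have := gN (n %/ i)%N _ (Ordinal (ltn_pmod n i_gt0)); rewrite /= mulnC -divn_eq.
by apply; rewrite /= leq_divRL // mulnC.
Qed.

End Deconvolution.

Section CycleLimit.
Variables (R : realType) (q : nat) (gamma : R).
Hypothesis q_gt0 : (0 < q)%N.

Local Notation cycle_prob := (cycle_prob q gamma).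

Lemma cycle_prob_split n i E : cycle_prob n E =
  \sum_(k < n.+1) cycle_prob n (fun f => (f i == k) && E f).
Proof.
rewrite exchange_big; apply: eq_bigr => s _ /=; rewrite -mulr_sumr; congr (_ * _).
case: (posnP i) => [i0|i_gt0].
  by rewrite big_ord_recl i0 ncycles0 eqxx big1 ?addr0.
have c_lt : (ncycles i s < n.+1)%N.
  by rewrite ltnS (leq_trans _ (ncycles_le s i)) // leq_pmull.
rewrite (bigD1 (Ordinal c_lt)) //= eqxx big1 ?addr0 // => k.
rewrite -(inj_eq val_inj) /= eq_sym => /negbTE ->.
by [].
Qed.

Lemma cycle_prob_convolution i r n E : (r < i)%N ->
  (forall f g, (forall j, j != i -> f j = g j) -> E f = E g) ->
  cycle_prob (i * n + r) E = convolution (cycle_coef q gamma i)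
    (fun t => cycle_prob (i * t + r) (fun f => (f i == 0%N) && E f)) n.
Proof.
move=> r_lt E_i; have i_gt0 : (0 < i)%N by apply: leq_ltn_trans r_lt.
have n_le : (n.+1 <= (i * n + r).+1)%N by rewrite ltnS (leq_trans _ (leq_addr _ _)) // leq_pmull.
have le_shift k : (i * k <= i * n + r)%N = (k < n.+1)%N.
  by rewrite [(i * k)%N]mulnC -leq_divRL // [(i * n)%N]mulnC divnMDl // divn_small ?addn0.
rewrite /convolution (cycle_prob_split _ i) (big_ord_widen _ (fun k => cycle_coef q gamma i k *
  cycle_prob (i * (n - k) + r) (fun f => (f i == 0%N) && E f)) n_le) [RHS]big_mkcond.
apply: eq_bigr => k _; rewrite cycle_prob_shift // le_shift.
case: ltnP => // k_lt; rewrite mulnBr addnBAC // leq_mul2l.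
by rewrite -ltnS k_lt orbT.
Qed.

Lemma cycle_prob_cvg (s : seq nat) (m : nat -> nat) :
  uniq s -> (forall i, i \in s -> (0 < i)%N) ->
  cycle_prob n (fun f => all (fun i => f i == m i) s) @[n --> \oo] -->
  \prod_(i <- s) poisson_geometrics (cycle_rate gamma i) (necklaces q i)
    (cycle_param q gamma i) (m i).
Proof.
elim: s => [_ _|i s IHs /= /andP[i_s s_uniq] s_pos].
  rewrite big_nil; under eq_fun do rewrite cycle_prob_true //.
  exact: cvg_cst.
have i_gt0 : (0 < i)%N by apply: s_pos; rewrite mem_head.
pose E f := all (fun i => f i == m i) s.
have E_i (f g : nat -> nat) : (forall j, j != i -> f j = g j) -> E f = E g.
  move=> fg; apply: eq_in_all => j js; rewrite fg //.
  by apply: contraNneq i_s => <-.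
have E_cvg := IHs s_uniq (fun j js => s_pos j (mem_behead (s := i :: s) js)).
rewrite -/E in E_cvg; set l := (X in _ --> X) in E_cvg.
pose g n := cycle_prob n (fun f => (f i == 0%N) && E f).
have g_cvg : g n @[n --> \oo] --> expR (- cycle_rate gamma i) *
    (1 - cycle_param q gamma i) ^+ necklaces q i * l.
  apply: (cvg_residues i_gt0) => r r_lt.
  apply: (pg_coef_deconvolution (e := fun n => cycle_prob (i * n + r) E)) => [n|].
    exact: cycle_prob_convolution.
  apply: cvg_comp E_cvg => P [N _ NP]; exists N => // n /= n_ge; apply: NP => /=.
  by rewrite (leq_trans n_ge) // (leq_trans _ (leq_addr _ _)) // leq_pmull.
rewrite big_cons -/l poisson_geometricsE -/(cycle_coef q gamma i) (mulrC _ (cycle_coef _ _ _ _)).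
(* Replacing [n] by [n + i * m i] keeps the limit and makes the deck large enough to lose [m i]
   cycles of length [i]. *)
rewrite -mulrA -(cvg_shiftn (i * m i)).
under eq_fun do rewrite cycle_prob_shift // leq_addl addnK.
by apply: cvgM => //; apply: cvg_cst.
Qed.

End CycleLimit.

(** * Random deck size *)

Lemma esum_finType (R : realType) (T : finType) (A : set T) (f : T -> R) :
  (forall x, 0 <= f x) ->
  \esum_(x in A) (f x)%:E = (\sum_(x | `[< A x >]) f x)%:E.
Proof.
move=> f_ge0; rewrite esum_mkcond.
have setTE : [set: T] = [set` enum T].
  by apply/seteqP; split=> x //= _; rewrite mem_enum.
rewrite esum_fset; last 2 first.
- exact: finite_finset.
- by move=> x _; case: ifP; rewrite ?lee_fin.
rewrite setTE -fsbig_seq ?enum_uniq //= big_enum /= -sumEFin [RHS]big_mkcond.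
by apply: eq_bigr => x _; congr (if _ then _ else _).
Qed.

Lemma Pr_finType (R : realType) (T : finType) (A : set T) (f : T -> R) :
  (forall x, 0 <= f x) -> Pr f A = \sum_(x | `[< A x >]) f x.
Proof. by move=> f_ge0; rewrite /Pr esum_finType. Qed.

Section RandomDeck.
Variables (R : realType) (u : R) (p : forall n, 'S_n -> R).
Hypotheses (u_ge0 : 0 <= u) (u_le1 : u <= 1) (p_ge0 : forall n s, 0 <= @p n s).

Lemma random_deck_esum (A : set {n : nat & 'S_n}) :
  \esum_(x in A) (random_deck_pmf u p x)%:E =
  \big[+%E/0%E]_(0 <= n <oo)
    ((1 - u) * u ^+ n * \sum_(s : 'S_n | `[< A (existT _ n s) >]) @p n s)%:E.
Proof.
have w_ge0 n : 0 <= (1 - u) * u ^+ n by rewrite mulr_ge0 ?subr_ge0 ?exprn_ge0.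
have m_ge0 x : (0 <= (random_deck_pmf u p x)%:E)%E.
  by rewrite lee_fin /random_deck_pmf mulr_ge0.
rewrite nneseries_esumT; last by move=> n; rewrite lee_fin mulr_ge0 // sumr_ge0.
pose J n : set {n : nat & 'S_n} := range (existT (fun n => 'S_n : Type) n).
have JT : [set: {n : nat & 'S_n}] = \bigcup_(n in [set: nat]) J n.
  by apply/seteqP; split=> // -[n s] _; exists n => //; exists s.
rewrite esum_mkcond JT esum_bigcupT; first last.
- by move=> x; case: ifP.
- by move=> n m _ _ [_ [[s _ <-] [s' _ /(congr1 tag)/= <-]]].
apply: eq_esum => n _; rewrite esum_image; last first.
  (* [tagged_as] reads the permutation back at the fixed size [n], which gives injectivity of the
     pairing. *)
  move=> s s' _ _ ss'; pose v := existT (fun n => 'S_n : Type) n s.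
  have vE (a : 'S_n) : tagged_as v (existT (fun n => 'S_n : Type) n a) = a.
    exact: (tagged_asE (u := v)).
  by rewrite -[s]vE -[s']vE; congr (tagged_as v _).
rewrite (eq_esum (b := fun s : 'S_n => (if `[< A (existT (fun n => 'S_n : Type) n s) >] then
    (1 - u) * u ^+ n * @p n s else 0)%:E)) => [|s _].
  rewrite esum_finType => [|s]; last by case: ifP => // _; rewrite mulr_ge0.
  rewrite mulr_sumr [in RHS]big_mkcond; congr (_%:E); apply: eq_bigl => s.
  exact/asboolP.
by rewrite -[(_ \in A)]/(`[< A _ >]); case: ifP.
Qed.

End RandomDeck.

(** * From integer words to the alphabet [0, ..., q] *)

Section ShuffleLink.
Variables (R : realType) (q : nat) (gamma : R) (alpha beta : nat -> R).
Hypotheses (q_gt0 : (0 < q)%N) (gamma01 : 0 <= gamma <= 1).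
Hypothesis alpha_low : forall i, (0 < i <= q)%N -> alpha i = (1 - gamma) / q%:R.
Hypothesis alpha_high : forall i, (q < i)%N -> alpha i = 0.
Hypothesis beta0 : forall i, (0 < i)%N -> beta i = 0.

Definition int_word n (w : {ffun 'I_n -> 'I_q.+1}) : {ffun 'I_n -> int} :=
  [ffun j => (w j : nat)%:Z].

Lemma int_word_inj n : injective (@int_word n).
Proof.
move=> w w' ww'; apply/ffunP => j; apply/val_inj.
by have := congr1 (fun f : {ffun 'I_n -> int} => f j) ww'; rewrite !ffunE => -[].
Qed.

Lemma letter_prob_ge0 a : 0 <= @letter_prob R q gamma a.
Proof.
have /andP[g0 g1] := gamma01.
by rewrite /letter_prob; case: ifP => // _; rewrite divr_ge0 ?subr_ge0 ?ler0n.
Qed.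

Lemma letter_pmf_nat (a : 'I_q.+1) :
  letter_pmf alpha beta gamma (a : nat)%:Z = letter_prob gamma a.
Proof.
case: a => -[|a] a_lt //=; rewrite /letter_prob /= alpha_low //.
Qed.

Lemma letter_pmf_out a : (forall b : 'I_q.+1, a <> (b : nat)%:Z) ->
  letter_pmf alpha beta gamma a = 0.
Proof.
case: a => [[|a]|a] aE /=; last exact: beta0.
  by have := aE ord0.
rewrite alpha_high // ltnNge; apply/negP => a_lt.
by apply: (aE (Ordinal (a_lt : a.+1 < q.+1)%N)).
Qed.

Lemma block_size_int_word n (w : {ffun 'I_n -> 'I_q.+1}) :
  block_size (int_word w) 0 = #|zeros w|.
Proof. by apply: eq_card => j; rewrite !inE ffunE eqz_nat. Qed.

Lemma written_under_int_word n (w : {ffun 'I_n -> 'I_q.+1}) s :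
  written_under (int_word w) s = word_compatible w s.
Proof.
apply: eq_forallb => j; rewrite !ffunE; case: (eqVneq (w j) ord0) => wj.
  rewrite wj ltxx block_size_int_word.
  have -> : block_start (int_word w) j = 0%N by apply: eq_card0 => k; rewrite !inE !ffunE wj.
  by rewrite add0n.
have -> : (0 < (w j : nat)%:Z :> int) = true by rewrite ltz_nat lt0n.
congr (_ == _); rewrite /rank -[RHS](cardID [pred k | w k < w j]%N); congr (_ + _)%N.
  apply: eq_card => k; rewrite !inE !ffunE ltz_nat /word_lt.
  by case: (w k < w j)%N; rewrite ?andbF.
apply: eq_card => k; rewrite !inE !ffunE eqz_nat /word_lt (inj_eq val_inj).
case: (eqVneq (w k) (w j)) => [->|_]; first by rewrite ltnn.
by rewrite andFb orbF andNb.
Qed.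

(** An integer word with a letter outside [0, ..., q] has mass 0, so the infinite sum reduces to
    words over the finite alphabet. *)
Lemma shuffle_pmfE n (s : 'S_n) :
  shuffle_pmf alpha beta gamma s = @shuffle_mass R q gamma n s.
Proof.
rewrite /shuffle_pmf; set F := fun w : {ffun 'I_n -> int} => _.
have F_out w : ~ range (@int_word n) w -> F w = 0%E.
  move=> w_out; have [j wj] : exists j, forall b : 'I_q.+1, w j <> (b : nat)%:Z.
    apply: contrapT => /forallNP w_in; apply: w_out.
    have /choice[v vw] : forall j, exists b : 'I_q.+1, w j = (b : nat)%:Z.
      by move=> j; apply: contrapT => /forallNP wj; apply: (w_in j).
    by exists [ffun j => v j] => //; apply/ffunP => j; rewrite !ffunE vw.
  by rewrite /F (bigD1 j) //= letter_pmf_out // !mul0r.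
have -> : \esum_(w in [set: {ffun 'I_n -> int}]) F w =
    \esum_(w in range (@int_word n)) F w.
  rewrite [RHS]esum_mkcond; apply: eq_esum => w _.
  by case: ifPn => //; rewrite notin_setE => /F_out.
rewrite esum_image; last by move=> w w' _ _; apply: int_word_inj.
rewrite (eq_esum (b := fun w => (if word_compatible w s then
    weight (letter_prob gamma) w / ((#|zeros w|)`!)%:R else 0)%:E)) => [|w _]; last first.
  rewrite /F block_size_int_word written_under_int_word; congr (_%:E).
  rewrite (eq_bigr (fun j => letter_prob gamma (w j))) => [|j _]; last first.
    by rewrite ffunE letter_pmf_nat.
  by case: ifP => _; rewrite ?mul1r // mul0r mulr0.
rewrite esum_finType => [|w]; last first.
  case: ifP => // _; rewrite divr_ge0 ?ler0n //.
  by apply: prodr_ge0 => j _; apply: letter_prob_ge0.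
rewrite /= /shuffle_mass [RHS]big_mkcond; apply: eq_bigl => w.
exact/asboolP.
Qed.

Lemma shuffle_mass_ge0 n (s : 'S_n) : 0 <= @shuffle_mass R q gamma n s.
Proof.
apply: sumr_ge0 => w _; rewrite divr_ge0 ?ler0n //.
by apply: prodr_ge0 => j _; apply: letter_prob_ge0.
Qed.

Lemma cycle_probE n (A : set 'S_n) (E : (nat -> nat) -> bool) :
  (forall s, A s <-> E (fun i => ncycles i s)) ->
  \sum_(s | `[< A s >]) shuffle_pmf alpha beta gamma s = cycle_prob q gamma n E.
Proof.
move=> AE; rewrite big_mkcond; apply: eq_bigr => s _; rewrite shuffle_pmfE.
have -> : `[< A s >] = E (fun i => ncycles i s).
  by apply/asboolP/idP; rewrite AE.
by case: (E _); rewrite ?mulr1 ?mulr0.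
Qed.

End ShuffleLink.

Section PoissonGeometricMass.
Variable R : realType.

Lemma eseries_EFin (f : nat -> R) (l : R) : series f n @[n --> \oo] --> l ->
  (\sum_(0 <= n <oo) (f n)%:E = l%:E)%E.
Proof.
move=> f_cvg; apply/cvg_lim => //; apply: cvg_EFin.
  by apply: nearW => n; rewrite /= sumEFin.
by rewrite [X in X @ _ --> _](_ : _ = series f) //; apply/funext => n; rewrite /= sumEFin.
Qed.

Lemma series_convolution1 (f : nat -> R) n : series f n.+1 = convolution (fun=> 1) f n.
Proof.
rewrite convolutionC /series /= big_mkord.
by apply: eq_bigr => k _; rewrite mulr1.
Qed.

(** Partial sums of a convolution are one factor convolved with the partial sums of the other, so
    total masses multiply. *)
Lemma poisson_geometrics_sum (lambda a : R) M : 0 <= a < 1 ->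
  series (poisson_geometrics lambda M a) n @[n --> \oo] --> (1 : R).
Proof.
move=> /andP[a_ge0 a_lt1]; elim: M => [|M IHM].
  have -> : series (poisson_geometrics lambda 0 a) =
      fun n => series (exp_coeff lambda) n * expR (- lambda).
    by apply/funext => n; rewrite /series /= mulr_suml.
  rewrite -[X in _ --> X](expRxMexpNx_1 lambda); apply: cvgM; last exact: cvg_cst.
  exact: is_cvg_series_exp_coeff.
rewrite -cvg_shiftS.
have -> : (fun n => series (poisson_geometrics lambda M.+1 a) n.+1) =
    convolution (geometric_mass a) (fun n => series (poisson_geometrics lambda M a) n.+1).
  apply/funext => n; rewrite series_convolution1 /poisson_geometrics iterS.
  rewrite convolutionA (eq_convolution (f' := convolution (geometric_mass a) (fun=> 1))
    (g' := poisson_geometrics lambda M a)) //; last by move=> k _; apply: convolutionC.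
  rewrite -convolutionA; apply: eq_convolution => // k _.
  by rewrite series_convolution1.
have geo_cvg : series (geometric_mass a) n @[n --> \oo] --> (1 : R).
  have a1 : `|a| < 1 by rewrite ger0_norm.
  have := @cvg_geometric_series R (1 - a) a a1.
  by rewrite mulfV ?subr_eq0 ?gt_eqF.
have geo_abs : (fun k => `|geometric_mass a k|) = geometric_mass a.
  apply/funext => k; rewrite ger0_norm // /geometric_mass mulr_ge0 ?exprn_ge0 //.
  by rewrite subr_ge0 ltW.
have : convolution (geometric_mass a)
    (fun n => series (poisson_geometrics lambda M a) n.+1) n @[n --> \oo] --> (1 * 1 : R).
  apply: convolution_cvg => //; first by rewrite geo_abs; apply/cvg_ex; exists 1.
  by rewrite cvg_shiftS.
by rewrite mulr1.
Qed.

End PoissonGeometricMass.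

(** * Cycle counts for a geometric deck size *)

Section DeckLaw.
Variables (R : realType) (q : nat) (gamma u : R).
Hypotheses (q_gt0 : (0 < q)%N) (gamma01 : 0 <= gamma <= 1) (u01 : 0 < u < 1).

Local Notation cycle_prob := (@cycle_prob R q gamma).

(** Extended real values allow nonnegative series to be split and interchanged freely; finiteness is
    [deck_prob_fin]. *)
Definition deck_prob (E : (nat -> nat) -> bool) : \bar R :=
  (\sum_(0 <= n <oo) ((1 - u) * u ^+ n * cycle_prob n E)%:E)%E.

Let u_ge0 : 0 <= u. Proof. by case/andP: u01 => /ltW. Qed.

Let size_ge0 n : 0 <= (1 - u) * u ^+ n.
Proof. by rewrite mulr_ge0 ?exprn_ge0 // subr_ge0; case/andP: u01 => _ /ltW. Qed.

Lemma cycle_prob_ge0 n E : 0 <= cycle_prob n E.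
Proof. by apply: sumr_ge0 => s _; rewrite mulr_ge0 ?shuffle_mass_ge0. Qed.

Let term_ge0 n E : (0 <= ((1 - u) * u ^+ n * cycle_prob n E)%:E)%E.
Proof. by rewrite lee_fin mulr_ge0 ?cycle_prob_ge0. Qed.

Lemma deck_prob_true : deck_prob (fun=> true) = 1%E.
Proof.
apply: eseries_EFin; under [X in series X]eq_fun do rewrite cycle_prob_true // mulr1.
have u1 : `|u| < 1 by rewrite ger0_norm //; case/andP: u01.
have := @cvg_geometric_series R (1 - u) u u1.
by rewrite mulfV ?subr_eq0 ?gt_eqF //; case/andP: u01.
Qed.

Lemma deck_prob_ge0 E : (0 <= deck_prob E)%E.
Proof. by apply: nneseries_ge0 => n _ _; apply: term_ge0. Qed.

Lemma deck_prob_fin E : deck_prob E \is a fin_num.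
Proof.
rewrite ge0_fin_numE ?deck_prob_ge0 // (@le_lt_trans _ _ 1%E) ?ltry //.
rewrite -deck_prob_true; apply: lee_nneseries => [n _ _|n _]; first exact: term_ge0.
rewrite lee_fin ler_wpM2l //; apply: ler_sum => s _.
by rewrite ler_wpM2l ?shuffle_mass_ge0 // lern1; case: (E _).
Qed.

(** The power of [u] is the weight of the [i * k] cards removed with the cycles. *)
Definition deck_coef i k : R := u ^+ (i * k) * cycle_coef q gamma i k.

Lemma deck_coef_ge0 i k : 0 <= deck_coef i k.
Proof.
have /andP[g0 g1] := gamma01.
rewrite mulr_ge0 ?exprn_ge0 ?pg_coef_ge0 // /cycle_rate /cycle_param.
  by rewrite divr_ge0 ?ler0n // subr_ge0 exprn_ile1 ?subr_ge0 // gerBl.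
by rewrite exprn_ge0 // divr_ge0 ?subr_ge0 ?ler0n.
Qed.

Section OneCoordinate.
Variables (i : nat) (E : (nat -> nat) -> bool).
Hypotheses (i_gt0 : (0 < i)%N)
  (E_i : forall f g, (forall j, j != i -> f j = g j) -> E f = E g).

Local Notation z := (deck_prob (fun f => (f i == 0%N) && E f)).

Lemma deck_prob_shift k :
  deck_prob (fun f => (f i == k) && E f) = ((deck_coef i k)%:E * z)%E.
Proof.
rewrite /deck_prob (@nneseries_split _ _ 0 (i * k)); last by move=> n _; apply: term_ge0.
rewrite add0n big_nat_cond big1 => [|n /andP[/andP[_ n_lt] _]]; last first.
  by rewrite cycle_prob_shift // leqNgt n_lt mulr0.
rewrite add0e -nneseries_addn // -nneseriesZl //; apply: eq_eseriesr => n _.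
rewrite cycle_prob_shift // leq_addl addnK -EFinM exprD /deck_coef; congr (_%:E).
by ring.
Qed.

Definition coef_sum (A : pred nat) : \bar R :=
  (\sum_(0 <= k <oo) (if A k then deck_coef i k else 0)%:E)%E.

Lemma deck_prob_in (A : pred nat) :
  deck_prob (fun f => A (f i) && E f) = (z * coef_sum A)%E.
Proof.
have zE := fineK (deck_prob_fin (fun f => (f i == 0%N) && E f)).
rewrite -zE -nneseriesZl; last first.
  by move=> k _; case: ifP; rewrite lee_fin ?deck_coef_ge0.
pose a n k : \bar R := (if A k then (1 - u) * u ^+ n *
  cycle_prob n (fun f => (f i == k) && E f) else 0)%:E.
have a_ge0 n k : (0 <= a n k)%E by rewrite /a; case: ifP => _; rewrite ?term_ge0.
(* The sums over the deck size and over the number [k] of [i]-cycles are exchanged; for fixed [k],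
   the sum over sizes is [deck_prob_shift]. *)
transitivity (\sum_(0 <= n <oo) \sum_(0 <= k <oo) a n k)%E.
  apply: eq_eseriesr => n _; rewrite (@nneseries_split _ _ 0 n.+1) // add0n.
  rewrite eseries0 => [|k n_lt _]; last first.
    rewrite /a cycle_prob_shift //; have -> : (i * k <= n)%N = false.
      by apply/negbTE; rewrite -ltnNge (leq_trans n_lt) // leq_pmull.
    by rewrite mulr0 if_same.
  rewrite adde0 big_mkord sumEFin (cycle_prob_split _ _ _ i) mulr_sumr.
  congr (_%:E); apply: eq_bigr => k _; case: ifPn => Ak.
    congr (_ * _); apply: eq_bigr => s _; congr (_ * (_ : bool)%:R).
    by case: eqP => // ->; rewrite Ak.
  rewrite [cycle_prob _ _]big1 ?mulr0 // => s _.
  by case: eqP => [->|_]; rewrite ?(negbTE Ak) mulr0.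
rewrite nneseries_interchange //; apply: eq_eseriesr => k _; rewrite /a.
case: ifP => _; last by rewrite mule0 eseries0.
by rewrite -/(deck_prob _) deck_prob_shift zE muleC.
Qed.

End OneCoordinate.

(* The event N_i in A and E has mass z_E * S_A, where S_A sums deck_coef i over A;
   as z_true * S_predT = 1, no normalizing constant has to be computed. *)
Lemma deck_prob_indep i E (A : pred nat) : (0 < i)%N ->
  (forall f g, (forall j, j != i -> f j = g j) -> E f = E g) ->
  deck_prob (fun f => A (f i) && E f) =
  (deck_prob (fun f => A (f i)) * deck_prob E)%E.
Proof.
move=> i_gt0 E_i.
have tt (B : pred nat) : deck_prob (fun f => B (f i)) =
    deck_prob (fun f => B (f i) && (fun=> true) f).
  by congr deck_prob; apply/funext => f; rewrite andbT.
have E_true : deck_prob E = deck_prob (fun f => predT (f i) && E f) by [].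
have one : (deck_prob (fun f => (f i == 0%N) && true) * coef_sum i predT = 1)%E.
  by rewrite -(@deck_prob_in i (fun=> true)) // deck_prob_true.
rewrite (tt A) E_true !deck_prob_in // muleACA -[LHS]mul1e -one muleACA.
rewrite [X in (_ * X)%E = _]muleC -!muleA; congr (_ * _)%E.
by rewrite (muleC (coef_sum i predT)) -muleA.
Qed.

(** The law of [N_i] and the claimed law are both proportional to [deck_coef i] and both have total
    mass 1, so they agree at 0 and hence everywhere. *)
Lemma deck_prob_eq i k : (0 < i)%N ->
  deck_prob (fun f => f i == k) =
  (poisson_geometrics (u ^+ i * (1 - (1 - gamma) ^+ i) / i%:R) (necklaces q i)
    ((u * (1 - gamma) / q%:R) ^+ i) k)%:E.
Proof.
move=> i_gt0; set PG := poisson_geometrics _ _ _.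
have /andP[g0 g1] := gamma01; have /andP[u_gt0 u_lt1] := u01.
have PGE m : PG m = PG 0%N * deck_coef i m.
  rewrite /PG !poisson_geometricsE pg_coef0 mulr1; congr (_ * _).
  by rewrite -(mulrA u) exprMn -(mulrA (u ^+ i)) pg_coef_scale /deck_coef exprM.
have PG_sum : (\sum_(0 <= m <oo) (PG m)%:E = 1)%E.
  apply: eseries_EFin; apply: poisson_geometrics_sum.
  have q1 : (1 <= q%:R :> R) by rewrite ler1n.
  have b_ge0 : 0 <= u * (1 - gamma) / q%:R.
    by rewrite divr_ge0 ?ler0n // mulr_ge0 // subr_ge0.
  rewrite exprn_ge0 // exprn_ilt1 -?lt0n //.
  rewrite ltr_pdivrMr ?ltr0n // mul1r (lt_le_trans _ q1) // (le_lt_trans _ u_lt1) //.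
  by rewrite ger_pMr // gerBl.
have -> : deck_prob (fun f => f i == k) = deck_prob (fun f => (f i == k) && true).
  by congr deck_prob; apply/funext => f; rewrite andbT.
suff zE : deck_prob (fun f => (f i == 0%N) && true) = (PG 0%N)%:E.
  by rewrite (deck_prob_shift (E := fun=> true)) // zE (PGE k) EFinM muleC.
have z_one : (deck_prob (fun f => (f i == 0%N) && true) * coef_sum i predT = 1)%E.
  by rewrite -(@deck_prob_in i (fun=> true)) // deck_prob_true.
have PG_one : ((PG 0%N)%:E * coef_sum i predT = 1)%E.
  rewrite -nneseriesZl; last by move=> m _; rewrite lee_fin deck_coef_ge0.
  by rewrite -PG_sum; apply: eq_eseriesr => m _; rewrite [in RHS]PGE.
by rewrite -[LHS]mule1 -PG_one muleCA z_one mule1.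
Qed.

Lemma deck_prob_all (s : seq nat) (A : nat -> pred nat) :
  uniq s -> (forall i, i \in s -> (0 < i)%N) ->
  deck_prob (fun f => all (fun i => A i (f i)) s) =
  (\prod_(i <- s) fine (deck_prob (fun f => A i (f i))))%:E.
Proof.
elim: s => [_ _|i s IHs /= /andP[i_s s_uniq] s_pos].
  by rewrite big_nil deck_prob_true.
rewrite deck_prob_indep => [||f g fg].
- rewrite IHs // => [|j js]; last by apply: s_pos; rewrite inE js orbT.
  by rewrite big_cons EFinM fineK ?deck_prob_fin.
- by apply: s_pos; rewrite mem_head.
apply: eq_in_all => j js; rewrite fg //.
by apply: contraNneq i_s => <-.
Qed.

End DeckLaw.

Local Open Scope ring_scope.

Theorem corollary3 (R : realType) (q : nat) (gamma : R)
    (alpha beta : nat -> R) :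
  (0 < q)%N -> 0 <= gamma <= 1 ->
  (forall i, (0 < i <= q)%N -> alpha i = (1 - gamma) / q%:R) ->
  (forall i, (q < i)%N -> alpha i = 0) ->
  (forall i, (0 < i)%N -> beta i = 0) ->
  exists M : nat -> nat,
    [/\ forall i, (0 < i)%N ->
          (M i)%:R = i%:R^-1 *
            \sum_(d <- divisors i) (moebius d)%:~R * q%:R ^+ (i %/ d) :> R,
        forall u : R, 0 < u < 1 ->
          let P := random_deck_pmf u (shuffle_pmf alpha beta gamma) in
          let N (i : nat) (x : {n : nat & 'S_n}) := ncycles i (tagged x) in
          mutually_independent P [set i | (0 < i)%N] N /\
          (forall i m, (0 < i)%N ->
            Pr P [set x | N i x = m] =
              poisson_geometrics (u ^+ i * (1 - (1 - gamma) ^+ i) / i%:R) (M i)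
                ((u * (1 - gamma) / q%:R) ^+ i) m)
      & forall (s : seq nat) (m : nat -> nat),
          uniq s -> (forall i, i \in s -> (0 < i)%N) ->
          Pr (@shuffle_pmf R alpha beta gamma n)
             [set pi | forall i, i \in s -> ncycles i pi = m i]
            @[n --> \oo] -->
          \prod_(i <- s)
            poisson_geometrics ((1 - (1 - gamma) ^+ i) / i%:R) (M i)
              (((1 - gamma) / q%:R) ^+ i) (m i)].
Proof.
move=> q_gt0 gamma01 alpha_low alpha_high beta0.
have pmf_ge0 n s : 0 <= @shuffle_pmf R alpha beta gamma n s.
  by rewrite (shuffle_pmfE gamma01 alpha_low alpha_high beta0) shuffle_mass_ge0.
(* The number of zero-free primitive necklaces of length [i] is the common [M i] of both parts. *)
exists (necklaces q); split=> [i i_gt0|u u01|s m s_uniq s_pos].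
- exact: necklacesE.
- move=> P N; have [u_ge0 u_le1] : 0 <= u /\ u <= 1 by case/andP: u01 => /ltW ? /ltW.
  have PE (A : set {n : nat & 'S_n}) (E : (nat -> nat) -> bool) :
      (forall x, A x <-> E (fun i => N i x)) -> Pr P A = fine (deck_prob q gamma u E).
    move=> AE; rewrite /Pr (random_deck_esum u_ge0 u_le1 pmf_ge0); congr fine.
    apply: eq_eseriesr => n _; congr (_ * _)%:E.
    by apply: (cycle_probE gamma01 alpha_low alpha_high beta0) => s; apply: AE.
  split=> [s A s_uniq s_pos|i m i_gt0]; last first.
    rewrite (PE _ (fun f => f i == m)) => [|x]; last by split=> [/eqP|/eqP].
    by rewrite deck_prob_eq.
  rewrite (PE _ (fun f => all (fun i => `[< A i (f i) >]) s)) => [|x]; last first.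
    by split=> [xA|/allP xA] => [|i /xA/asboolP//]; apply/allP => i /xA Ai; apply/asboolP.
  rewrite (deck_prob_all q_gt0 gamma01 u01 (fun i k => `[< A i k >])) //=; apply: eq_bigr => i _.
  by rewrite (PE _ (fun f => `[< A i (f i) >])) // => x; split=> /asboolP.
have PrE n : Pr (@shuffle_pmf R alpha beta gamma n)
    [set pi | forall i, i \in s -> ncycles i pi = m i] =
    cycle_prob q gamma n (fun f => all (fun i => f i == m i) s).
  rewrite Pr_finType //.
  apply: (cycle_probE gamma01 alpha_low alpha_high beta0) => pi.
  by split=> [piA|/allP piA i /piA/eqP//]; apply/allP => i /piA ->.
under eq_fun do rewrite PrE.
exact: cycle_prob_cvg.
Qed.
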